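(* Let $I\subset\mathbb{R}$ be a bounded interval, let $\mathcal{H}$ be a separable real Hilbert space, let $1<p\le 2$ and $\tfrac1p+\tfrac1q=1$. Let $\delta\in(0,\tfrac12]$, and let $\mathcal{F}_0\subseteq\mathcal{F}_1\subseteq\dots$ be a filtration of the Borel $\sigma$-algebra on $I$ that is regular with parameter $\delta$. Let $\boldsymbol{B}$ be the Bellman function $$\boldsymbol{B}(x) = \sup\Bigl\{\bigl\langle g\,T[f-\langle f\rangle_I]\bigr\rangle_I \;\Bigm|\; \langle f\rangle_I=x_1,\ \langle g^2\rangle_I-\operatorname{osc}_I^2(T^*g)=x_2,\ \langle|f|^p\rangle_I=x_3,\ \langle|g|^q\rangle_I=x_4\Bigr\},$$ where $x=(x_1,x_2,x_3,x_4)\in\mathcal{H}\times\mathbb{R}_{\ge0}^3$ and the supremum is taken over all $f\in S(I,\mathcal{H})$, $g\in L^2(I)$ and $T\in\mathcal{G}(I,\mathcal{H})$ satisfying the four identities after the bar. Let $\Omega_{\boldsymbol{B}}$ be the set of all $x$ for which this supremum is taken over a non-empty set. If $B\in\mathcal{K}^p_\delta(\mathcal{H})$, then $\boldsymbol{B}(x)\le B(x)$ for all $x\in\Omega_{\boldsymbol{B}}$.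
   Context: $|E|$ denotes Lebesgue measure of $E\subseteq I$; $L^r(I,\mathcal{H})$ is the Bochner space of $\mathcal{H}$-valued functions on $I$, and $L^r(I)$ the space of real-valued functions. For $x,y\in\mathcal{H}$, $xy$ is the inner product and $|x|$ the norm. Regular filtration with parameter $\delta$: $\mathcal{F}_0=\{I,\emptyset\}$, each $\mathcal{F}_n$ is a finite algebra of Borel subsets of $I$, and whenever $J$ is an atom of $\mathcal{F}_n$, $Q$ is an atom of $\mathcal{F}_{n+1}$ and $Q\subseteq J$, one has $|Q|/|J|\ge\delta$. Put $\mathcal{F}_\infty=\sigma(\bigcup_n\mathcal{F}_n)$. For $f\in L^1(I,\mathcal{H})$, $\mathbb{E}_nf=\mathbb{E}[f\mid\mathcal{F}_n]$ (conditional expectation with respect to normalized Lebesgue measure on $I$). A martingale is a sequence $\{f_n\}_{n\ge0}$ in $L^1(I,\mathcal{H})$ with $\mathbb{E}_mf_n=f_m$ for $m\le n$. It is simple if $f_{n+1}\equiv f_n$ for all sufficiently large $n$; a simple martingale is identified with its limit function $f$ (so $f_n=\mathbb{E}_nf$). $S(I,\mathcal{H})$ is the space of simple martingales. Class $\mathcal{G}(I,\mathcal{H})$ (relative to the given filtration): all linear operators $T$ from $S(I,\mathcal{H})$ to measurable scalar (real) functions on $I$ such that, for every $f\in S(I,\mathcal{H})$: (G1) $\|Tf\|_{L^2}\le\|f\|_{L^2}$; (G2) if $\Delta_0f:=f_0\equiv\mathbf{0}$ and, for each $n>0$, $\Delta_nf:=f_n-f_{n-1}=\mathbf{1}_{e_n}\Delta_nf$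 for some $e_n\in\mathcal{F}_{n-1}$, then $\{|Tf|>0\}\subset\bigcup_{n>0}e_n$ (up to a null set). By (G1), $T$ is regarded as a bounded linear operator $L^2(I,\mathcal{F}_\infty,\mathcal{H})\to L^2(I)$ (where $L^2(I,\mathcal{F}_\infty,\mathcal{H})$ consists of the $\mathcal{F}_\infty$-measurable functions in $L^2(I,\mathcal{H})$), and $T^*:L^2(I)\to L^2(I,\mathcal{F}_\infty,\mathcal{H})$ is its adjoint. Averages and oscillation: $\langle f\rangle_J=\frac1{|J|}\int_Jf$ and $\operatorname{osc}_J^2(f)=\bigl\langle|f-\langle f\rangle_J|^2\bigr\rangle_J=\langle|f|^2\rangle_J-|\langle f\rangle_J|^2$. Set $\Omega_p=\{x\in\mathcal{H}\times\mathbb{R}_{\ge0}^3 : |x_1|^p\le x_3,\ x_2^q\le x_4^2\}$; one has $\Omega_{\boldsymbol{B}}\subseteq\Omega_p$. Class $\mathcal{K}^p_\delta(\mathcal{H})$: all continuous functions $B:\Omega_p\to\mathbb{R}$ such that (B1) if $x\in\Omega_p$ and $|x_1|^p=x_3$, then $B(x)\ge0$; (B2) whenever $N\in\mathbb{N}$, $x,x^1,\dots,x^N\in\Omega_p$, $d\in\mathbb{R}$, and $\lambda_1,\dots,\lambda_N\ge\delta$ with $\lambda_1+\dots+\lambda_N=1$ satisfy $\sum_{k=1}^N\lambda_kx^k-x=(\mathbf{0},d^2,0,0)$, one has $$B(x)\ge|d|\,\operatorname{diam}\{x_1^1,\dots,x_1^N\}+\sum_{k=1}^N\lambda_kB(x^k),$$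 where $x_1^k\in\mathcal{H}$ is the first component of $x^k$ and the diameter is taken in the norm of $\mathcal{H}$. *)

(* Defs.v *)
From HB Require Import structures.
From mathcomp Require Import all_boot all_order all_algebra.
From mathcomp Require Import all_classical all_reals all_analysis.
Set Implicit Arguments.
Unset Strict Implicit.
Unset Printing Implicit Defensive.
Import Order.TTheory GRing.Theory Num.Theory numFieldNormedType.Exports.
Local Open Scope classical_set_scope.
Local Open Scope ring_scope.

(* A separable real Hilbert space is a complete normed space whose norm comes
   from the inner product [dot] and which has a countable dense subset. *)
Definition separable_hilbert (R : realType) (H : completeNormedModType R)
    (dot : {dot H for idfun}) : Prop :=
  (forall x : H, `|x| ^+ 2 = dot x x) /\
  (exists2 D : set H, countable D & dense D).

Definition diam (R : realType) (H : normedModType R) (A : set H) : R :=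
  sup [set r | exists x y, [/\ A x, A y & r = `|x - y|]].

Section bochner.
Context {R : realType} {V : completeNormedModType R}.
Local Notation mu := (@lebesgue_measure R).
Implicit Types (A D : set R) (f s : R -> V).

(* Measurability of [f] on [D] for the sets of [G] and the Borel sets of [V];
   for a sigma-algebra or a finite algebra [G] on [D] open sets suffice. *)
Definition bmeasurable (G : set (set R)) D f : Prop :=
  forall U : set V, open U -> G (D `&` f @^-1` U).

Definition simple_function A s : Prop :=
  [/\ bmeasurable measurable A s, finite_set (s @` A) &
      (\int[mu]_(t in A) (`|s t|)%:E < +oo)%E].

Definition simple_integral A s : V :=
  \sum_(v \in s @` A) fine (mu (A `&` s @^-1` [set v])) *: v.

Definition is_bochner_integral A f (v : V) : Prop :=
  bmeasurable measurable A f /\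
  exists s_ : nat -> R -> V,
    [/\ forall n, simple_function A (s_ n),
        (fun n => \int[mu]_(t in A) (`|f t - s_ n t|)%:E)%E @ \oo --> 0%E &
        (fun n => simple_integral A (s_ n)) @ \oo --> v].

(* Junk value [0] if [f] is not Bochner integrable on [A]. *)
Definition bochner_integral A f : V :=
  xget 0 [set v | is_bochner_integral A f v].

Definition L2norm A f : \bar R :=
  ((\int[mu]_(t in A) (`|f t| ^+ 2)%:E) `^ 2^-1)%E.

Definition in_L1 A f : Prop :=
  bmeasurable measurable A f /\ (\int[mu]_(t in A) (`|f t|)%:E < +oo)%E.

Definition in_L2 (G : set (set R)) A f : Prop :=
  bmeasurable G A f /\ (L2norm A f < +oo)%E.

(* Averages of scalar functions are extended real, so that an equation
   [average J u = x%:E] expresses in particular that the average is finite. *)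
Definition average (J : set R) (u : R -> R) : \bar R :=
  (((fine (mu J))^-1)%:E * \int[mu]_(t in J) (u t)%:E)%E.

Definition baverage (J : set R) f : V :=
  (fine (mu J))^-1 *: bochner_integral J f.

Definition osc2 (J : set R) f : \bar R :=
  average J (fun t => `|f t - baverage J f| ^+ 2).

End bochner.

Section filtration.
Context {R : realType}.
Local Notation mu := (@lebesgue_measure R).
Variable I : set R.

Definition finite_borel_algebra (G : set (set R)) : Prop :=
  [/\ finite_set G, (forall A, G A -> A `<=` I /\ measurable A),
      G set0, (forall A, G A -> G (I `\` A)) & setU_closed G].

Definition atom (G : set (set R)) (J : set R) : Prop :=
  [/\ G J, J !=set0 & forall A, G A -> A `<=` J -> A = set0 \/ A = J].

(* As division by 0 gives 0, the last condition with [0 < delta] forces every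
   atom to have positive measure. *)
Definition regular_filtration (delta : R) (F : nat -> set (set R)) : Prop :=
  [/\ F 0%N = [set I; set0],
      (forall n, finite_borel_algebra (F n)),
      (forall n, F n `<=` F n.+1) &
      (forall n J Q, atom (F n) J -> atom (F n.+1) Q -> Q `<=` J ->
        delta <= fine (mu Q) / fine (mu J))].

Definition Finfty (F : nat -> set (set R)) : set (set R) :=
  <<s I, \bigcup_n F n>>.

End filtration.

(* Functions on [I] are functions on [R] whose values off [I] are irrelevant. *)
Section operators.
Context {R : realType} {H : completeNormedModType R}.
Local Notation mu := (@lebesgue_measure R).
Variables (dot : {dot H for idfun}) (I : set R) (F : nat -> set (set R)).

Definition is_condexp (G : set (set R)) (f g : R -> H) : Prop :=
  [/\ bmeasurable G I g, in_L1 I g &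
      forall A, G A -> bochner_integral A g = bochner_integral A f].

Definition martingale (f_ : nat -> R -> H) : Prop :=
  (forall n, in_L1 I (f_ n)) /\
  (forall m n, (m <= n)%N -> is_condexp (F m) (f_ n) (f_ m)).

(* Since [f_ n] is [F n]-measurable and all atoms have positive measure, almost
   everywhere equality on [I] of such functions is equality on [I]. *)
Definition simple_martingale (f_ : nat -> R -> H) (f : R -> H) : Prop :=
  martingale f_ /\
  exists N, forall n, (N <= n)%N ->
    (forall t, I t -> f_ n.+1 t = f_ n t) /\ (forall t, I t -> f_ n t = f t).

Definition simple_space (f : R -> H) : Prop :=
  exists f_, simple_martingale f_ f.

(* [T] is only constrained on [simple_space]; its values are representatives of
   functions on [I] up to null sets. The contraction property and linearity make
   [T f] depend, up to a null set, only on the restriction of [f] to [I]. *)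
Definition classG (T : (R -> H) -> R -> R) : Prop :=
  [/\ (forall f, simple_space f -> measurable_fun I (T f)),
      (forall (a : R) f g, simple_space f -> simple_space g ->
        {ae mu, forall t, I t ->
          T (fun s => a *: f s + g s) t = a * T f t + T g t}),
      (forall f, simple_space f -> (L2norm I (T f) <= L2norm I f)%E) &
      (forall f f_ (e : nat -> set R), simple_martingale f_ f ->
        (forall t, I t -> f_ 0%N t = 0) ->
        (forall n, F n (e n.+1)) ->
        (forall n t, I t ->
          f_ n.+1 t - f_ n t = \1_(e n.+1) t *: (f_ n.+1 t - f_ n t)) ->
        {ae mu, forall t, I t -> 0 < `|T f t| -> exists n, e n.+1 t})].

(* [u] is the value at [f] of the extension of [T] by continuity to
   L^2(I, F_infty, H), in which [simple_space] is dense. *)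
Definition extension (T : (R -> H) -> R -> R) (f : R -> H) (u : R -> R)
    : Prop :=
  in_L2 measurable I u /\
  exists s_ : nat -> R -> H,
    [/\ forall k, simple_space (s_ k),
        (fun k => L2norm I (fun t => s_ k t - f t)) @ \oo --> 0%E &
        (fun k => L2norm I (fun t => T (s_ k) t - u t)) @ \oo --> 0%E].

(* [h] represents the image of [g] under the adjoint of the extension of [T];
   such an [h] exists and is unique up to a null set if [classG T] holds and [g]
   is in L^2(I). *)
Definition is_adjoint (T : (R -> H) -> R -> R) (g : R -> R) (h : R -> H)
    : Prop :=
  in_L2 (Finfty I F) I h /\
  forall f u, in_L2 (Finfty I F) I f -> extension T f u ->
    (\int[mu]_(t in I) (u t * g t)%:E =
     \int[mu]_(t in I) (dot (f t) (h t))%:E)%E.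

Definition bellman_set (p q : R) (x : H * R * R * R) : set (\bar R) :=
  let: (x1, x2, x3, x4) := x in
  [set y : \bar R | exists (f : R -> H) (g : R -> R) T h,
    [/\ simple_space f, in_L2 measurable I g, classG T & is_adjoint T g h] /\
    [/\ baverage I f = x1,
        (average I (fun t => g t ^+ 2)%R - osc2 I h = x2%:E)%E,
        average I (fun t => `|f t| `^ p) = x3%:E,
        average I (fun t => `|g t| `^ q) = x4%:E &
        y = average I (fun t => g t * T (fun s => f s - baverage I f) t)]].

Definition bellman (p q : R) (x : H * R * R * R) : \bar R :=
  ereal_sup (bellman_set p q x).

Definition Omega_bellman (p q : R) : set (H * R * R * R) :=
  [set x | let: (x1, x2, x3, x4) := x in
    [/\ 0 <= x2, 0 <= x3, 0 <= x4 & bellman_set p q x !=set0]].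

End operators.

Section majorants.
Context {R : realType} {H : completeNormedModType R}.

Definition Omega (p q : R) : set (H * R * R * R) :=
  [set x | let: (x1, x2, x3, x4) := x in
    [/\ 0 <= x2, 0 <= x3, 0 <= x4, `|x1| `^ p <= x3 & x2 `^ q <= x4 ^+ 2]].

Definition classK (p q delta : R) (B : H * R * R * R -> R) : Prop :=
  [/\ {within Omega p q, continuous B},
      (forall x1 x2 x3 x4, Omega p q (x1, x2, x3, x4) ->
        `|x1| `^ p = x3 -> 0 <= B (x1, x2, x3, x4)) &
      (forall (N : nat) (x : H * R * R * R) (x_ : 'I_N -> H * R * R * R)
          (d : R) (lambda : 'I_N -> R),
        Omega p q x -> (forall k, Omega p q (x_ k)) ->
        (forall k, delta <= lambda k) -> \sum_k lambda k = 1 ->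
        \sum_k lambda k *: x_ k - x = (0, d ^+ 2, 0, 0) ->
        `|d| * diam (range (fun k => (x_ k).1.1.1)) +
          \sum_k lambda k * B (x_ k) <= B x)].

End majorants.

(* Main.v *)
(* For [f] constant on the atoms of [F N], attach to every atom [J] of level at
   most [N] the point [x_J] whose entries are the average of [f] on [J], the
   average of [g^2] minus the variance of [hN], and the averages of [|f|^p] and
   [|g|^q].  Here [hN] is the [F N]-conditional expectation of [T^* g], projected
   onto the finite-dimensional span [W] of the values of [f].  Splitting [J] into
   its children changes the second entry by the variance [d^2] of the averages
   of [hN], so (B2) applies, and its term [|d| diam] dominates the contribution
   of the martingale difference to [<T^* g, f>].  Downward induction from the
   leaves, where (B1) gives [B >= 0], bounds [<g, T (f - <f>)>] by [B] at the
   root.  The points [x_J] lie in [Omega] by Jensen's inequality and because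
   [T] maps [1_J (hN - <hN>_J)] to a function supported in [J], whence the
   variance is at most the average of [g^2].
   Replacing [T^* g] by [hN] only increases the second entry, and (B2) with
   a single child says that [B] is nonincreasing in it. *)
Require Import Defs.
From HB Require Import structures.
From mathcomp Require Import all_boot all_order all_algebra finmap.
From mathcomp Require Import all_classical all_reals all_analysis.
From mathcomp Require Import measurable_realfun ring lra.
Import Order.TTheory GRing.Theory Num.Theory numFieldNormedType.Exports.
Local Open Scope classical_set_scope.
Local Open Scope ring_scope.
Set Implicit Arguments.
Unset Strict Implicit.
Unset Printing Implicit Defensive.

(** * Inner products, finite-dimensional spans and Riesz representation on them *)

Section inner_product.
Context {R : realType} {H : completeNormedModType R} (dot : {dot H for idfun}).
Hypothesis dotE : forall x : H, `|x| ^+ 2 = dot x x.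
Implicit Types (u v w : H) (s : seq H).

Lemma dotC u v : dot u v = dot v u.
Proof. by have := hermC dot u v; rewrite expr0 mul1r. Qed.

Lemma dotZl a u v : dot (a *: u) v = a * dot u v.
Proof. by rewrite linearZl_LR. Qed.

Lemma dotZr a u v : dot u (a *: v) = a * dot u v.
Proof. by rewrite dotC dotZl dotC. Qed.

Lemma dotDl u v w : dot (u + v) w = dot u w + dot v w.
Proof. exact: linearDl. Qed.

Lemma dotDr u v w : dot u (v + w) = dot u v + dot u w.
Proof. exact: linearDr. Qed.

Lemma dotBl u v w : dot (u - v) w = dot u w - dot v w.
Proof. exact: linearBl. Qed.

Lemma dotBr u v w : dot u (v - w) = dot u v - dot u w.
Proof. exact: linearBr. Qed.

Lemma dot0l u : dot 0 u = 0. Proof. exact: linear0l. Qed.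

Lemma dot0r u : dot u 0 = 0. Proof. exact: linear0r. Qed.

Lemma dot_sumr (J : Type) (r : seq J) (P : pred J) (E : J -> H) u :
  dot u (\sum_(j <- r | P j) E j) = \sum_(j <- r | P j) dot u (E j).
Proof. exact: linear_sumr. Qed.

Lemma sqrnormD u v : `|u + v| ^+ 2 = `|u| ^+ 2 + 2 * dot u v + `|v| ^+ 2.
Proof. by rewrite !dotE dotDl !dotDr (dotC v u); ring. Qed.

Lemma sqrnormB u v : `|u - v| ^+ 2 = `|u| ^+ 2 - 2 * dot u v + `|v| ^+ 2.
Proof. by rewrite sqrnormD linearNr normrN; ring. Qed.

(** Cauchy-Schwarz: the squared norm of [|v| u - |u| v] equals [2 |u| |v| (|u| |v| - dot u v)]. *)
Lemma ler_dot u v : dot u v <= `|u| * `|v|.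
Proof.
have [->|u0] := eqVneq u 0; first by rewrite dot0l normr0 mul0r.
have [->|v0] := eqVneq v 0; first by rewrite dot0r normr0 mulr0.
have {}u0 : 0 < `|u| by rewrite normr_gt0.
have {}v0 : 0 < `|v| by rewrite normr_gt0.
have := sqr_ge0 `| `|v| *: u - `|u| *: v|.
rewrite sqrnormB !normrZ !normr_id dotZl dotZr.
rewrite (_ : _ + _ = 2 * (`|u| * `|v|) * (`|u| * `|v| - dot u v)); last by ring.
by rewrite pmulr_rge0 ?subr_ge0// !mulr_gt0.
Qed.

Lemma ler_norm_dot u v : `|dot u v| <= `|u| * `|v|.
Proof.
rewrite ler_norml ler_dot andbT lerNl -linearNl/= -(normrN u).
exact: ler_dot.
Qed.

(** Take [w] to be [u - v]. This reduces identities between vector integrals to identities between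
    real ones. *)
Lemma dot_inj u v : (forall w, dot w u = dot w v) -> u = v.
Proof.
move=> uv; apply/eqP; rewrite -subr_eq0 -normr_eq0 -sqrf_eq0 dotE.
by rewrite dotBr uv subrr.
Qed.

Lemma dot_continuous w : continuous (dot w).
Proof.
move=> x; apply/cvgrPdist_le => /= e e0.
near=> y; rewrite -dotBr (le_trans (ler_norm_dot _ _))//.
have w1 : 0 < `|w| + 1 by rewrite ltr_pwDr.
have : `|x - y| <= e / (`|w| + 1).
  by near: y; apply: cvgr_dist_le => //; exact: divr_gt0.
rewrite ler_pdivlMr// => xye; apply: le_trans xye.
by rewrite mulrC ler_wpM2l// lerDl.
Unshelve. all: by end_near. Qed.

Definition subspace (S : set H) :=
  S 0 /\ forall a u v, S u -> S v -> S (a *: u + v).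

(** As the intersection of all subspaces containing [D]: a linear property passes from [D] to its
    span by choosing [S]. *)
Definition span (D : set H) : set H :=
  [set v | forall S, subspace S -> D `<=` S -> S v].

Lemma subspace_span D : subspace (span D).
Proof.
split=> [S [S0 _]//|a u v Du Dv S sS DS].
by apply: sS.2; [exact: Du|exact: Dv].
Qed.

Lemma sub_span D : D `<=` span D.
Proof. by move=> v Dv S _; exact. Qed.

Lemma spanD D u v : span D u -> span D v -> span D (u + v).
Proof.
by move=> Du Dv; rewrite -(scale1r u); exact: (subspace_span D).2.
Qed.

Lemma spanZ D a u : span D u -> span D (a *: u).
Proof.
move=> Du; rewrite -[_ *: _]addr0; apply: (subspace_span D).2 => //.
exact: (subspace_span D).1.
Qed.

Lemma spanB D u v : span D u -> span D v -> span D (u - v).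
Proof.
by move=> Du Dv; apply: spanD => //; rewrite -scaleN1r; exact: spanZ.
Qed.

Lemma span_sum D (J : Type) (r : seq J) (P : pred J) (E : J -> H) :
  (forall j, P j -> span D (E j)) -> span D (\sum_(j <- r | P j) E j).
Proof.
move=> DE; apply: big_ind => //; first exact: (subspace_span D).1.
exact: spanD.
Qed.

(** Gram-Schmidt by induction on the list: the representative on the span of [s] is corrected along
    the component of the new vector orthogonal to that span. *)
Lemma span_riesz_seq s (l : H -> R) :
    (forall a u v, l (a *: u + v) = a * l u + l v) ->
  exists2 w, span [set` s] w & forall v, span [set` s] v -> dot v w = l v.
Proof.
have ext (k : H -> R) t w : (forall a u v, k (a *: u + v) = a * k u + k v) ->
    {in t, forall v, dot v w = k v} ->
    forall v, span [set` t] v -> dot v w = k v.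
  move=> klin tw v /(_ [set v | dot v w = k v]); apply=> [|u/= /tw//].
  split=> [|a x y /= xw yw] /=.
    by have := klin (-1) 0 0; rewrite scaler0 addr0 dot0l; lra.
  by rewrite dotDl dotZl xw yw klin.
have mono x t : span [set` t] `<=` span [set` x :: t].
  move=> v tv; apply: tv; first exact: subspace_span.
  by move=> u/= ut; apply: sub_span; rewrite /= inE ut orbT.
elim: s l => [|x s IH] l llin.
  exists 0; first exact: (subspace_span _).1.
  exact: ext.
have linx a u v : dot x (a *: u + v) = a * dot x u + dot x v.
  by rewrite dotDr dotZr.
have [w0 sw0 w0E] : exists2 w, span [set` s] w &
    forall v, span [set` s] v -> dot v w = l v.
  exact: IH.
(* The orthogonal projection of [x] onto the span of [s], found as the representative of [dot x]. *)
have [p sp pE] : exists2 w, span [set` s] w &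
    forall v, span [set` s] v -> dot v w = dot x v.
  exact: IH.
pose y := x - p.
have sy : span [set` x :: s] y.
  by apply: spanB; [apply: sub_span; rewrite /= mem_head|exact: mono].
have xs : x = y + p by rewrite subrK.
have yperp v : span [set` s] v -> dot v y = 0.
  by move=> sv; rewrite dotBr pE// (dotC x) subrr.
have lD u v : l (u + v) = l u + l v.
  by rewrite -(scale1r u) llin mul1r scale1r.
(* The coefficient makes the pairing with [y] equal to [l y]. If [y = 0], division by zero gives
   coefficient 0, which is right because [l 0 = 0]. *)
exists (w0 + ((l y - dot y w0) / `|y| ^+ 2) *: y).
  by apply: spanD; [exact: mono|exact: spanZ].
apply: ext => // v; rewrite inE => /predU1P[->|vs].
- rewrite {1}xs dotDl /= !dotDr !dotZr (yperp p)// mulr0 addr0.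
  rewrite (w0E p)// [in RHS]xs lD -dotE.
  have [->|y0] := eqVneq y 0.
    rewrite dot0l normr0 expr0n mulr0.
    by have := llin (-1) 0 0; rewrite scaler0 addr0; lra.
  have ny : `|y| != 0 by rewrite normr_eq0.
  by field.
- have sv : span [set` s] v by exact: sub_span.
  by rewrite dotDr dotZr yperp// mulr0 addr0 w0E.
Qed.

End inner_product.

(** * One application of (B2), for the children of an atom *)

Section bellman_step.
Context {R : realType} {H : completeNormedModType R} (dot : {dot H for idfun}).
Hypothesis dotE : forall x : H, `|x| ^+ 2 = dot x x.

(** The supremum defining [diam] is over a bounded set: twice the sum of all norms is an upper
    bound. *)
Lemma le_diam N (a : 'I_N -> H) k j : `|a k - a j| <= diam (range a).
Proof.
apply: ub_le_sup; last by exists (a k), (a j); split.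
exists (\sum_i `|a i| + \sum_i `|a i|) => _ [_ [_ [[i _ <-] [l _ <-] ->]]].
rewrite (le_trans (ler_normB _ _))// lerD//.
- by rewrite (bigD1 i)//= lerDl sumr_ge0.
- by rewrite (bigD1 l)//= lerDl sumr_ge0.
Qed.

Lemma sum_quadruple N (x : 'I_N -> H * R * R * R) :
  \sum_k x k = (\sum_k (x k).1.1.1, \sum_k (x k).1.1.2, \sum_k (x k).1.2,
                \sum_k (x k).2).
Proof.
have E (V : nmodType) (phi : H * R * R * R -> V) : phi 0 = 0 ->
    {morph phi : y z / y + z} -> \sum_k phi (x k) = phi (\sum_k x k).
  by move=> phi0 phiD; rewrite (big_morph phi phiD phi0).
rewrite (E _ (fun z => z.1.1.1))// (E _ (fun z => z.1.1.2))//.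
rewrite (E _ (fun z => z.1.2))// (E _ (fun z => z.2))//.
by case: (\sum_k x k) => [[[]]].
Qed.

(** The difference of the two sides is the weighted variance of [y]. *)
Lemma jensen_sqr N (l y : 'I_N -> R) : (forall k, 0 <= l k) -> \sum_k l k = 1 ->
  (\sum_k l k * y k) ^+ 2 <= \sum_k l k * y k ^+ 2.
Proof.
move=> l0 l1; set t := \sum_k _; rewrite -subr_ge0.
suff -> : \sum_k l k * y k ^+ 2 - t ^+ 2 = \sum_k l k * (y k - t) ^+ 2.
  by apply: sumr_ge0 => k _; rewrite mulr_ge0// sqr_ge0.
have -> u : \sum_k l k * (y k - u) ^+ 2 = \sum_k l k * y k ^+ 2 -
    2 * u * (\sum_k l k * y k) + u ^+ 2 * \sum_k l k.
  rewrite !mulr_sumr -sumrB -big_split/=; apply: eq_bigr => k _; ring.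
by rewrite l1 -/t; ring.
Qed.

(** (B2) in terms of masses: [m] is the length of an atom and [m_ k] are those of its children, so
    the weights are [m_ k / m]. The sum of inner products is at most [m] times [|d|] times the
    diameter, by Cauchy-Schwarz and Jensen. *)
Lemma bellman_step (p q delta : R) B N (m : R) (m_ : 'I_N -> R)
    (a c : H) (a_ c_ : 'I_N -> H) (b r s : R) (b_ r_ s_ : 'I_N -> R) :
  classK p q delta B -> 0 < delta -> 0 < m ->
  (forall k, delta <= m_ k / m) -> \sum_k m_ k = m ->
  Omega p q (a, b, r, s) -> (forall k, Omega p q (a_ k, b_ k, r_ k, s_ k)) ->
  \sum_k m_ k *: a_ k = m *: a ->
  \sum_k m_ k * b_ k = m * b + \sum_k m_ k * `|c_ k - c| ^+ 2 ->
  \sum_k m_ k * r_ k = m * r -> \sum_k m_ k * s_ k = m * s ->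
  \sum_k m_ k * dot (a_ k - a) (c_ k) +
    \sum_k m_ k * B (a_ k, b_ k, r_ k, s_ k) <= m * B (a, b, r, s).
Proof.
move=> [_ _ KB] delta0 m0 dm summ Ox Ox_ suma sumb sumr sums.
pose l k := m_ k / m.
have l0 k : 0 <= l k by rewrite (le_trans _ (dm k))// ltW.
have l1 : \sum_k l k = 1 by rewrite -mulr_suml summ divff ?gt_eqF.
have lE (u : 'I_N -> R) : \sum_k m_ k * u k = m * \sum_k l k * u k.
  rewrite mulr_sumr; apply: eq_bigr => k _.
  by rewrite /l mulrA [m * _]mulrCA divff ?gt_eqF// mulr1.
have lEH (u : 'I_N -> H) : \sum_k m_ k *: u k = m *: \sum_k l k *: u k.
  rewrite scaler_sumr; apply: eq_bigr => k _.
  by rewrite /l scalerA [m * _]mulrCA divff ?gt_eqF// mulr1.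
have mN0 : m != 0 by rewrite gt_eqF.
have {}suma : \sum_k l k *: a_ k = a.
  by move: suma; rewrite lEH => /(scalerI mN0).
have {}sumr : \sum_k l k * r_ k = r by move: sumr; rewrite lE => /(mulfI mN0).
have {}sums : \sum_k l k * s_ k = s by move: sums; rewrite lE => /(mulfI mN0).
have {}sumb : \sum_k l k * b_ k = b + \sum_k l k * `|c_ k - c| ^+ 2.
  by move: sumb; rewrite !lE -mulrDr => /(mulfI mN0).
set S := \sum_k l k * `|_| ^+ 2 in sumb.
have S0 : 0 <= S by apply: sumr_ge0 => k _; exact: mulr_ge0 (l0 k) (sqr_ge0 _).
(* The number [d] in (B2) is the root of the weighted second moment [S] of the [c_ k] about [c]. *)
have xE : \sum_k l k *: (a_ k, b_ k, r_ k, s_ k) - (a, b, r, s) =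
    (0, Num.sqrt S ^+ 2, 0, 0) :> H * R * R * R.
  rewrite sum_quadruple /= suma sumr sums sumb sqr_sqrtr//.
  by congr (_, _, _, _); rewrite /= ?subrr// addrAC subrr add0r.
have KBx0 := KB N _ _ _ _ Ox Ox_ dm l1 xE; move: KBx0.
rewrite (ger0_norm (sqrtr_ge0 _)); set D := diam _ => KBx.
have aD k : `|a_ k - a| <= D.
  (* A deviation from the mean is the mean of the pairwise differences, each of norm at most the
     diameter. *)
  have -> : a_ k - a = \sum_j l j *: (a_ k - a_ j).
    under eq_bigr do rewrite scalerBr.
    by rewrite sumrB -scaler_suml l1 scale1r suma.
  rewrite (le_trans (ler_norm_sum _ _ _))// -[leRHS]mul1r -l1 mulr_suml.
  by apply: ler_sum => j _; rewrite normrZ ger0_norm// ler_wpM2l// le_diam.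
have D0 : 0 <= D.
  have [k _|N0] := pickP (fun _ : 'I_N => true).
    exact: le_trans (normr_ge0 _) (aD k).
  by move/eqP: l1; rewrite big_pred0// eq_sym oner_eq0.
rewrite !lE -mulrDr ler_pM2l// (le_trans _ KBx)// lerD2r.
(* The weighted sum of the [a_ k - a] vanishes, so [c] may be subtracted from every [c_ k]. *)
have -> : \sum_k l k * dot (a_ k - a) (c_ k) =
    \sum_k l k * dot (a_ k - a) (c_ k - c).
  apply/eqP; rewrite -subr_eq0 -sumrB.
  rewrite (eq_bigr (fun k => dot (l k *: (a_ k - a)) c)); last first.
    by move=> k _; rewrite dotZl dotBr; ring.
  rewrite -linear_sumlz/=; under eq_bigr do rewrite scalerBr.
  by rewrite sumrB -scaler_suml l1 scale1r suma subrr dot0l.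
apply: (@le_trans _ _ (D * \sum_k l k * `|c_ k - c|)).
  rewrite mulr_sumr ler_sum// => k _; rewrite mulrCA ler_wpM2l//.
  by rewrite (le_trans (ler_dot dotE _ _))// ler_wpM2r.
rewrite mulrC ler_wpM2r// -(ler_sqr (x := \sum_k _)) ?nnegrE ?sqrtr_ge0//.
  by rewrite sqr_sqrtr// jensen_sqr.
by apply: sumr_ge0 => k _; rewrite mulr_ge0.
Qed.

End bellman_step.

(** * Real integrals over finite partitions *)

Section partition.
Context d (T : measurableType d) (R : realType)
  (mu : {measure set T -> \bar R}).
Local Open Scope ring_scope.

Lemma integrable_setU (A B : set T) (u : T -> R) :
  measurable A -> measurable B -> [disjoint A & B] ->
  mu.-integrable A (EFin \o u) -> mu.-integrable B (EFin \o u) ->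
  mu.-integrable (A `|` B) (EFin \o u).
Proof.
move=> mA mB AB /integrableP[mAu Au] /integrableP[mBu Bu].
have mABu : measurable_fun (A `|` B) u.
  by apply/measurable_funU => //; split; exact/measurable_EFinP.
apply/integrableP; split; first exact/measurable_EFinP.
rewrite ge0_integral_setU//; first exact: lte_add_pinfty.
by apply: measurableT_comp => //; exact/measurable_EFinP.
Qed.

(** Induction over an enumeration of [P]. Integrability on the union is carried along because
    additivity of the real integral requires it. *)
Lemma Rintegral_partition (J : choiceType) (P : set J) (K : J -> set T) u :
    finite_set P -> (forall j, P j -> measurable (K j)) -> trivIset P K ->
    (forall j, P j -> mu.-integrable (K j) (EFin \o u)) ->
  mu.-integrable (\bigcup_(j in P) K j) (EFin \o u) /\
  \int[mu]_(t in \bigcup_(j in P) K j) u t =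
    \sum_(j <- fset_set P) \int[mu]_(t in K j) u t.
Proof.
move=> finP mK tP iK; rewrite -bigsetU_fset_set//.
have : {subset enum_fset (fset_set P) <= P} by move=> j; rewrite in_fset_set.
move: (enum_fset _) (fset_uniq (fset_set P)) => s.
elim: s => [_ _|j s IH /= /andP[js us] sP].
  rewrite !big_nil Rintegral_set0; split=> //; exact: integrable_set0.
have Pj : P j by exact: set_mem (sP _ (mem_head _ _)).
have {}sP i : i \in s -> P i.
  by move=> si; apply: (set_mem (sP _ _)); rewrite inE si orbT.
have [iU IU] := IH us (fun i si => mem_set (sP i si)).
have mU : measurable (\big[setU/set0]_(i <- s) K i).
  by rewrite big_seq; apply: bigsetU_measurable => i /sP; exact: mK.
have dU : [disjoint K j & \big[setU/set0]_(i <- s) K i].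
  apply/eqP; rewrite big_distrr/= big_seq big1// => i si.
  have /trivIsetP := tP; apply=> //; first exact: sP.
  by apply/eqP => ji; rewrite ji si in js.
have iKU := integrable_setU (mK _ Pj) mU dU (iK _ Pj) iU.
by rewrite !big_cons; split=> //; rewrite Rintegral_setU ?IU//; exact: mK.
Qed.

End partition.

(** * Bochner integrals tested against vectors *)

Section bochner.
Context {R : realType} {H : completeNormedModType R} (dot : {dot H for idfun}).
Hypothesis dotE : forall x : H, `|x| ^+ 2 = dot x x.
Local Notation mu := (@lebesgue_measure R).
Implicit Types (A : set R) (f s : R -> H).

Lemma integrableDR A (u v : R -> R) : measurable A ->
  mu.-integrable A (EFin \o u) -> mu.-integrable A (EFin \o v) ->
  mu.-integrable A (EFin \o (fun t => u t + v t)).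
Proof. by move=> mA iu iv; apply: eq_integrable (integrableD _ iu iv). Qed.

Lemma integrableBR A (u v : R -> R) : measurable A ->
  mu.-integrable A (EFin \o u) -> mu.-integrable A (EFin \o v) ->
  mu.-integrable A (EFin \o (fun t => u t - v t)).
Proof. by move=> mA iu iv; apply: eq_integrable (integrableB _ iu iv). Qed.

Lemma integrableZR A k (u : R -> R) : measurable A ->
  mu.-integrable A (EFin \o u) ->
  mu.-integrable A (EFin \o (fun t => k * u t)).
Proof. by move=> mA iu; apply: eq_integrable (integrableZl _ k iu). Qed.

Lemma bmeasurable_comp A f (phi : H -> R) : measurable A ->
  bmeasurable measurable A f -> continuous phi -> measurable_fun A (phi \o f).
Proof.
move=> mA mf cphi; apply: (measurability _ (RGenOInfty.measurableE R)).
move=> _ [_ [x ->] <-]; rewrite comp_preimage; apply: mf.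
apply: open_comp; last exact: rray_open.
by move=> t _; exact: cphi.
Qed.

(** Points are closed, so a fibre is the complement in [A] of the preimage of an open set. *)
Lemma bmeasurable_fiber A f v : measurable A -> bmeasurable measurable A f ->
  measurable (A `&` f @^-1` [set v]).
Proof.
move=> mA mf; have -> : A `&` f @^-1` [set v] = A `\` (A `&` f @^-1` ~` [set v]).
  apply/seteqP; split=> t /= [At ftv]; split=> //; first by case.
  by apply: contrapT => ftNv; apply: ftv.
apply: measurableD => //; apply: mf; apply: closed_openC.
apply: accessible_closed_set1; apply: hausdorff_accessible.
exact: norm_hausdorff.
Qed.

Lemma simple_partition A s (u : R -> R) : measurable A ->
    bmeasurable measurable A s -> finite_set (s @` A) ->
    (forall v, mu.-integrable (A `&` s @^-1` [set v]) (EFin \o u)) ->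
  mu.-integrable A (EFin \o u) /\ \int[mu]_(t in A) u t =
    \sum_(v <- fset_set (s @` A)) \int[mu]_(t in A `&` s @^-1` [set v]) u t.
Proof.
move=> mA ms fins iu.
have AE : A = \bigcup_(v in s @` A) (A `&` s @^-1` [set v]).
  apply/seteqP; split=> [t At|t [v _ []//]].
  by exists (s t) => //; exists t.
have tr : trivIset (s @` A) (fun v => A `&` s @^-1` [set v]).
  by move=> v w _ _ [t [[_ /= <-] [_ /= <-]]].
have [] := @Rintegral_partition _ _ _ mu _ _
  (fun v => A `&` s @^-1` [set v]) u fins _ tr (fun v _ => iu v).
  by move=> v _; exact: bmeasurable_fiber.
by rewrite -AE.
Qed.

Lemma simple_measurable A s (u : R -> R) : measurable A ->
    bmeasurable measurable A s -> finite_set (s @` A) ->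
    (forall v, measurable_fun (A `&` s @^-1` [set v]) u) ->
  measurable_fun A u.
Proof.
move=> mA ms fins mu_; have -> : A = \bigcup_(v in s @` A) (A `&` s @^-1` [set v]).
  apply/seteqP; split=> [t At|t [v _ []//]].
  by exists (s t) => //; exists t.
move=> _ Y mY; rewrite setI_bigcupl; apply: fin_bigcup_measurable => // v _.
by apply: mu_ => //; exact: bmeasurable_fiber.
Qed.

Lemma integrable_cst A k : measurable A -> (mu A < +oo)%E ->
  mu.-integrable A (EFin \o cst k).
Proof.
move=> mA Aoo; apply: measurable_bounded_integrable => //.
by exists `|k|; split=> [|M kM t _]; [exact: num_real|exact: ltW].
Qed.

Lemma le_integrable_real A (u v : R -> R) : measurable A -> measurable_fun A u ->
  (forall t, A t -> `|u t| <= v t) -> mu.-integrable A (EFin \o v) ->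
  mu.-integrable A (EFin \o u).
Proof.
move=> mA mu_ uv; apply: le_integrable => //; first exact/measurable_EFinP.
by move=> t At; rewrite /= lee_fin (le_trans (uv _ At))// ler_norm.
Qed.

Lemma dot_simple_integral A s : measurable A -> (mu A < +oo)%E ->
    simple_function A s -> forall w,
  mu.-integrable A (EFin \o (dot w \o s)) /\
  dot w (simple_integral A s) = \int[mu]_(t in A) dot w (s t).
Proof.
move=> mA Aoo [ms fins _] w.
have iv v : mu.-integrable (A `&` s @^-1` [set v]) (EFin \o (dot w \o s)).
  have mAv := bmeasurable_fiber v mA ms.
  have vAoo : (mu (A `&` s @^-1` [set v]) < +oo)%E.
    by apply: le_lt_trans Aoo; apply: le_measure; rewrite ?inE.
  apply: eq_integrable (integrable_cst (dot w v) mAv vAoo) => //.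
  by move=> t /set_mem[_ /= ->].
have [iws ->] := simple_partition mA ms fins iv; split=> //.
rewrite /simple_integral fsbig_finite// dot_sumr; apply: eq_bigr => v _.
rewrite dotZr mulrC -Rintegral_cst; last exact: bmeasurable_fiber.
by apply: eq_Rintegral => t /set_mem[_ /= ->].
Qed.

(** Along the approximating simple functions, the inner products of [w] with their integrals
    converge to [dot w v] by continuity and to the real integral by L1 convergence; the two limits
    agree. *)
Lemma dot_is_bochner_integral A f v : measurable A -> (mu A < +oo)%E ->
    (forall w, mu.-integrable A (EFin \o (dot w \o f))) ->
    is_bochner_integral A f v ->
  forall w, dot w v = \int[mu]_(t in A) dot w (f t).
Proof.
move=> mA Aoo iwf [mf [s_ [ss fs sv]]] w.
(* Measurability is checked on each fibre of [s_ n], where the function is [|f - x|] with [x]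
   fixed. *)
have mfs n : measurable_fun A (fun t => `|f t - s_ n t|).
  have [ms fins _] := ss n.
  apply: (simple_measurable mA ms fins) => x.
  apply: (@eq_measurable_fun _ _ _ _ _ (fun t => `|f t - x|)).
    by move=> t /set_mem[_ /= ->].
  apply: (@measurable_funS _ _ _ _ A) => //.
  apply: (bmeasurable_comp (phi := fun y => `|y - x|)) => // y.
  by apply: cvg_norm; apply: cvgB => //; exact: cvg_cst.
have le_n n : ((`|dot w (simple_integral A (s_ n)) -
    \int[mu]_(t in A) dot w (f t)|)%:E <=
    `|w|%:E * \int[mu]_(t in A) (`|f t - s_ n t|)%:E)%E.
  have [iws ->] := dot_simple_integral mA Aoo (ss n) w.
  rewrite -RintegralB//; last exact: iwf.
  have iB : mu.-integrable A (EFin \o (fun t => dot w (s_ n t) - dot w (f t))).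
    exact: (integrableBR mA iws (iwf w)).
  rewrite EFin_normr_Rintegral//; apply: le_trans (le_abse_integral _ _ _) _ => //.
    exact: measurable_int iB.
  have /measurable_EFinP mfsE := mfs n.
  rewrite -ge0_integralZl//.
  apply: ge0_le_integral => //.
  - by apply: measurableT_comp => //; exact: measurable_int iB.
  - by apply: emeasurable_funM => //; exact: mfsE.
  - move=> t At /=; rewrite -EFinM lee_fin -dotBr distrC.
    by rewrite (ler_norm_dot dotE).
have lim1 : (fun n => dot w (simple_integral A (s_ n))) @ \oo --> dot w v.
  by apply: continuous_cvg sv; exact: (dot_continuous dotE).
suff lim2 : (fun n => dot w (simple_integral A (s_ n))) @ \oo -->
    \int[mu]_(t in A) dot w (f t).
  by rewrite -(cvg_lim _ lim1)// -(cvg_lim _ lim2).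
apply/cvgrPdist_le => /= e e0.
have : (`|dot w (simple_integral A (s_ n)) -
    \int[mu]_(t in A) dot w (f t)|)%:E @[n --> \oo] --> 0%E.
  have := cvgeZl (y := `|w|%:E) isT fs; rewrite mule0.
  apply: squeeze_cvge; last exact: cvg_cst.
  by near=> n; rewrite lee_fin normr_ge0/= le_n.
move=> /fine_cvgP[_] /cvgr_dist_le /(_ e e0).
apply: filterS => n /=; rewrite sub0r normrN normr_id distrC; exact.
Unshelve. all: by end_near. Qed.

End bochner.

(** * Finite algebras, their atoms and functions constant on atoms *)

Section algebra.
Context {R : realType} (I : set R) (G : set (set R)).
Hypothesis fbG : finite_borel_algebra I G.
Implicit Types A B J K : set R.

Lemma algebra_sub A : G A -> A `<=` I.
Proof. by case: fbG => _ h _ _ _ /h[]. Qed.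

Lemma algebra_measurable A : G A -> measurable A.
Proof. by case: fbG => _ h _ _ _ /h[]. Qed.

Lemma algebra0 : G set0. Proof. by case: fbG. Qed.

Lemma algebraC A : G A -> G (I `\` A).
Proof. by case: fbG => _ _ _ h _; exact: h. Qed.

Lemma algebraT : G I. Proof. by rewrite -(setD0 I); exact/algebraC/algebra0. Qed.

Lemma algebraU A B : G A -> G B -> G (A `|` B).
Proof. by case: fbG => _ _ _ _ h; exact: h. Qed.

Lemma algebraI A B : G A -> G B -> G (A `&` B).
Proof.
move=> GA GB; have -> : A `&` B = I `\` ((I `\` A) `|` (I `\` B)).
  rewrite setDUr !setDD -setIIr; apply/esym/setIidPr.
  by move=> t [/(algebra_sub GA)].
by apply: algebraC; apply: algebraU; exact: algebraC.
Qed.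

Lemma algebra_bigcup (P : set (set R)) (h : set R -> set R) : P `<=` G ->
  (forall A, P A -> G (h A)) -> G (\bigcup_(A in P) h A).
Proof.
move=> PG Gh; have finP : finite_set P.
  by apply: sub_finite_set PG _; case: fbG.
rewrite -bigsetU_fset_set// big_seq; elim/big_ind: _ => [|A B|A].
- exact: algebra0.
- exact: algebraU.
- by rewrite in_fset_set// => /set_mem; exact: Gh.
Qed.

(** For [t] in [I] this is the atom containing [t]. For other [t] no member of [G] contains [t], and
    the cell is the whole line. *)
Definition cell (t : R) : set R := [set s | forall A, G A -> A t -> A s].

Lemma cell_refl t : cell t t. Proof. by []. Qed.

(** The cell is the complement in [I] of a finite union of complements of members. *)
Lemma algebra_cell t : I t -> G (cell t).
Proof.
move=> It; have -> : cell t = I `\` \bigcup_(A in [set A | G A /\ A t]) (I `\` A).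
  apply/seteqP; split=> [s ts|s [Is Ns] A GA At].
    split; first exact: ts algebraT It.
    by move=> [A [GA At] [_]]; apply; exact: ts.
  by apply: contrapT => NAs; apply: Ns; exists A.
apply: algebraC; apply: algebra_bigcup => [A []//|A [GA _]]; exact: algebraC.
Qed.

Lemma cell_atom t : I t -> atom G (cell t).
Proof.
move=> It; split; [exact: algebra_cell|by exists t|move=> A GA At].
have [tA|tNA] := pselect (A t).
  by right; apply/seteqP; split=> // s; apply.
left; apply/seteqP; split=> // s As.
by have [] := At _ As _ (algebraC GA) (conj It tNA).
Qed.

Lemma atom_cell J t : atom G J -> J t -> J = cell t.
Proof.
move=> [GJ _ minJ] Jt; have It : I t by exact: algebra_sub Jt.
have cJ : cell t `<=` J by move=> s; apply.
by have [c0|//] := minJ _ (algebra_cell It) cJ; have : cell t t by []; rewrite c0.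
Qed.

Definition atoms_in A : set (set R) := [set K | atom G K /\ K `<=` A].

Lemma atom_algebra J : atom G J -> G J. Proof. by case. Qed.

Lemma finite_atoms_in A : finite_set (atoms_in A).
Proof.
by have [finG _ _ _ _] := fbG; apply: sub_finite_set finG => J [/atom_algebra].
Qed.

Lemma trivIset_atoms_in A : trivIset (atoms_in A) id.
Proof.
move=> J K [aJ _] [aK _] [t [/= Jt Kt]].
by rewrite (atom_cell aJ Jt) (atom_cell aK Kt).
Qed.

Lemma bigcup_atoms_in A : G A -> \bigcup_(K in atoms_in A) K = A.
Proof.
move=> GA; apply/seteqP; split=> [t [K [_ KA] /KA//]|t At].
exists (cell t) => //; split; first exact/cell_atom/(algebra_sub GA).
by move=> s; apply.
Qed.

Definition step (V : Type) (f : R -> V) :=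
  forall J, atom G J -> forall s t, J s -> J t -> f s = f t.

Lemma finite_step (V : Type) A (f : R -> V) : G A -> step f -> finite_set (f @` A).
Proof.
move=> GA sf; apply: (sub_finite_set (B := (fun K => f (get K)) @` atoms_in A)).
  move=> _ [t At <-]; rewrite -(bigcup_atoms_in GA) in At.
  have [K [aK KA] Kt] := At.
  exists K => //; apply: (sf K) => //; exact: (getI Kt).
exact/finite_image/finite_atoms_in.
Qed.

Section measurability.
Context {V : completeNormedModType R}.
Implicit Type f : R -> V.

(** If [f] took two values on an atom, the ball about one of them with radius their distance would
    have a preimage splitting the atom. Conversely, the preimage of a set is the finite union of the
    atoms inside it. *)
Lemma bmeasurable_step f : bmeasurable G I f <-> step f.
Proof.
split=> [mf J aJ s t Js Jt|sf U oU].
  apply: contrapT => fst.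
  have d0 : 0 < `|f s - f t| by rewrite normr_gt0 subr_eq0; exact/eqP.
  have GU := mf _ (ball_open (f s) `|f s - f t|).
  have [GJ _ minJ] := aJ.
  have [J0|JE] := minJ _ (algebraI GJ GU) (@subIsetl _ _ _).
    have : (J `&` (I `&` f @^-1` ball (f s) `|f s - f t|)) s.
      by split=> //; split; [exact: algebra_sub Js|exact: ballxx].
    by rewrite J0.
  by move: Jt; rewrite -JE => -[_ [_ /=]]; rewrite -ball_normE/= ltxx.
have -> : I `&` f @^-1` U =
    \bigcup_(K in [set K | atom G K /\ K `<=` I `&` f @^-1` U]) K.
  apply/seteqP; split=> [t [It Ut]|t [K [_ KU] /KU//]].
  exists (cell t) => //; split; first exact: cell_atom.
  move=> s ts; split; first exact: ts algebraT It.
  by rewrite /= (sf _ (cell_atom It) s t).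
by apply: algebra_bigcup => [K [/atom_algebra]//|K [/atom_algebra]].
Qed.

Lemma bmeasurable_algebra A f : G A -> bmeasurable G I f ->
  bmeasurable measurable A f.
Proof.
move=> GA mf U oU; apply: algebra_measurable.
have -> : A `&` f @^-1` U = A `&` (I `&` f @^-1` U).
  by rewrite setIA (setIidl (algebra_sub GA)).
by apply: algebraI => //; exact: mf.
Qed.

End measurability.
End algebra.

(** * Regular filtrations, step functions and simple martingales *)

Section filtration.
Context {R : realType} {H : completeNormedModType R} (dot : {dot H for idfun}).
Hypothesis dotE : forall x : H, `|x| ^+ 2 = dot x x.
Local Notation mu := (@lebesgue_measure R).
Local Notation m A := (fine (mu A)).
Variables (I : set R) (delta : R) (F : nat -> set (set R)).
Hypotheses (mI : measurable I) (Ioo : (mu I < +oo)%E) (I0 : (0 < mu I)%E).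
Hypotheses (delta0 : 0 < delta) (regF : regular_filtration I delta F).
Implicit Types (A J K Q : set R) (f : R -> H).

Lemma filtration_algebra n : finite_borel_algebra I (F n).
Proof. by case: regF. Qed.
Local Notation fbF := (filtration_algebra _).

Lemma filtration_mono k n : (k <= n)%N -> F k `<=` F n.
Proof.
case: regF => _ _ Fn _; elim: n => [|n IH]; first by rewrite leqn0 => /eqP ->.
by rewrite leq_eqVlt => /predU1P[->//|/IH kn]; apply: subset_trans (Fn n).
Qed.

Lemma filtration_sub n A : F n A -> A `<=` I.
Proof. exact: (algebra_sub fbF). Qed.

Lemma filtration_measurable n A : F n A -> measurable A.
Proof. exact: (algebra_measurable fbF). Qed.

Lemma filtration_lty n A : F n A -> (mu A < +oo)%E.
Proof.
move=> FA; apply: le_lt_trans Ioo; apply: le_measure; rewrite ?inE//.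
  exact: filtration_measurable FA.
exact: filtration_sub FA.
Qed.

Lemma filtration_I n : F n I. Proof. exact: (algebraT fbF). Qed.

Lemma atom0 J : atom (F 0%N) J -> J = I.
Proof.
have [-> _ _ _] := regF.
by move=> [[->//|->] [t]].
Qed.

Lemma atomI : atom (F 0%N) I.
Proof.
have [-> _ _ _] := regF; split; first by left.
- by apply/set0P; apply: contraTneq I0 => ->; rewrite measure0 ltxx.
- by move=> A [->|->] _; [right|left].
Qed.

Lemma cell_mono k n t : (k <= n)%N -> cell (F n) t `<=` cell (F k) t.
Proof. by move=> kn s ts A FA; apply: ts; exact: filtration_mono FA. Qed.

(** At a positive level, the ratio of [J] to its parent cell is at least [delta > 0], so its
    numerator is not 0. At level 0 the atom is [I]. *)
Lemma atom_gt0 n J : atom (F n) J -> 0 < m J.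
Proof.
case: n => [/atom0 ->|n aJ]; first by rewrite fine_gt0// I0.
have [_ _ _ reg] := regF; have [_ [t Jt] _] := aJ.
have It : I t by apply: (filtration_sub (atom_algebra aJ)).
have := reg _ _ _ (cell_atom fbF It) aJ; rewrite lt0r fine_ge0// andbT.
rewrite (atom_cell fbF aJ Jt) => /(_ (cell_mono (leqnSn n))).
move=> /(lt_le_trans delta0).
by apply: contraTneq => ->; rewrite mul0r ltxx.
Qed.

Lemma Rintegral_atoms n A (u : R -> R) : F n A ->
    (forall K, atom (F n) K -> K `<=` A -> mu.-integrable K (EFin \o u)) ->
  mu.-integrable A (EFin \o u) /\
  \int[mu]_(t in A) u t =
    \sum_(K <- fset_set (atoms_in (F n) A)) \int[mu]_(t in K) u t.
Proof.
move=> FA iu; rewrite -{1 2}(bigcup_atoms_in fbF FA).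
apply: (@Rintegral_partition _ _ _ mu _ _ id).
- exact: (finite_atoms_in fbF).
- by move=> K [/atom_algebra /filtration_measurable].
- exact: (trivIset_atoms_in fbF).
- by move=> K [aK KA]; exact: iu.
Qed.

Lemma step_mono (V : Type) (f : R -> V) k n : (k <= n)%N ->
  step (F k) f -> step (F n) f.
Proof.
move=> kn sf J aJ s t Js Jt.
have It : I t by apply: (filtration_sub (atom_algebra aJ)).
apply: (sf _ (cell_atom fbF It)) => //; apply: (cell_mono kn).
by rewrite -(atom_cell fbF aJ Jt).
Qed.

Lemma step_comp (V W : Type) (f : R -> V) (phi : V -> W) n :
  step (F n) f -> step (F n) (phi \o f).
Proof. by move=> sf J aJ s t Js Jt /=; rewrite (sf J aJ s t). Qed.

Lemma step_cell (V : Type) (f : set R -> V) n : step (F n) (fun t => f (cell (F n) t)).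
Proof.
by move=> J aJ s t Js Jt; rewrite -(atom_cell fbF aJ Js) -(atom_cell fbF aJ Jt).
Qed.

Lemma integrable_const_atom n K (u : R -> R) c : atom (F n) K ->
  (forall t, K t -> u t = c) ->
  mu.-integrable K (EFin \o u) /\ \int[mu]_(t in K) u t = m K * c.
Proof.
move=> /atom_algebra FK uc; split.
  have := integrable_cst c (filtration_measurable FK) (filtration_lty FK).
  by apply: eq_integrable => // [|t /set_mem /uc /= ->//]; exact: filtration_measurable FK.
rewrite mulrC -Rintegral_cst; last exact: filtration_measurable FK.
by apply: eq_Rintegral => t /set_mem; exact: uc.
Qed.

(** Function and set are moved to the common level [maxn N n], on whose atoms [u] is constant. *)
Lemma integrable_step N n (u : R -> R) A : step (F N) u -> F n A ->
  mu.-integrable A (EFin \o u).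
Proof.
move=> /(step_mono (leq_maxl N n)) su /(filtration_mono (leq_maxr N n)) FA.
apply: (proj1 (Rintegral_atoms FA _)) => K aK _.
have [_ [s Ks] _] := aK.
exact: (proj1 (integrable_const_atom aK (fun t Kt => su K aK t s Kt Ks))).
Qed.

Lemma step_bmeasurable N n f A : step (F N) f -> F n A ->
  bmeasurable measurable A f.
Proof.
move=> /(step_mono (leq_maxl N n)) su /(filtration_mono (leq_maxr N n)) FA.
by apply: (bmeasurable_algebra fbF FA); exact/(bmeasurable_step fbF).
Qed.

Lemma step_simple_function N n f A : step (F N) f -> F n A -> simple_function A f.
Proof.
move=> sf FA; split; first exact: (step_bmeasurable sf FA).
- have sf' := step_mono (leq_maxl N n) sf.
  have FA' := filtration_mono (leq_maxr N n) FA.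
  exact: (finite_step fbF FA' sf').
- have := integrable_step (step_comp (fun x : H => `|x|) sf) FA.
  by move=> /integrable_lty; apply; exact: filtration_measurable FA.
Qed.

(** The constant sequence [f] witnesses Bochner integrability, so [xget] does not return its
    default; the value is determined by its inner products. *)
Lemma bochner_integral_step N n f A : step (F N) f -> F n A ->
  bochner_integral A f = simple_integral A f.
Proof.
move=> sf FA; have ssf := step_simple_function sf FA.
have mA := filtration_measurable FA; have Aoo := filtration_lty FA.
have dsi := dot_simple_integral dot mA Aoo ssf.
have : is_bochner_integral A f (bochner_integral A f).
  rewrite /bochner_integral; apply: xgetPex; exists (simple_integral A f).
  split; first by case: ssf.
  exists (fun=> f); split=> //; last exact: cvg_cst.
  under eq_fun do under eq_integral do rewrite subrr normr0.
  by rewrite integral0; exact: cvg_cst.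
move=> /(dot_is_bochner_integral dotE mA Aoo (fun w => (dsi w).1)) bE.
by apply: (dot_inj dotE) => w; rewrite bE (dsi w).2.
Qed.

Lemma dot_bochner_integral N n f A w : step (F N) f -> F n A ->
  dot w (bochner_integral A f) = \int[mu]_(t in A) dot w (f t).
Proof.
move=> sf FA; rewrite (bochner_integral_step sf FA).
have mA := filtration_measurable FA; have Aoo := filtration_lty FA.
exact: (dot_simple_integral dot mA Aoo (step_simple_function sf FA) w).2.
Qed.

Lemma span_baverage N n f A : step (F N) f -> F n A ->
  span (f @` A) (baverage A f).
Proof.
move=> sf FA; rewrite /baverage (bochner_integral_step sf FA); apply: spanZ.
have [_ finf _] := step_simple_function sf FA.
rewrite /simple_integral fsbig_finite// big_seq; apply: span_sum => v.
by rewrite in_fset_set// => /set_mem fv; apply: spanZ; exact: sub_span.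
Qed.

Lemma dot_baverage N n f A w : step (F N) f -> F n A -> 0 < m A ->
  m A * dot w (baverage A f) = \int[mu]_(t in A) dot w (f t).
Proof.
move=> sf FA mA; rewrite dotZr mulrA divff ?gt_eqF// mul1r.
exact: dot_bochner_integral sf FA.
Qed.

Lemma baverage_const N n f J t : step (F N) f -> (N <= n)%N -> atom (F n) J ->
  J t -> baverage J f = f t.
Proof.
move=> sf Nn aJ Jt; apply: (dot_inj dotE) => w.
have mJ := atom_gt0 aJ.
apply: (mulfI (lt0r_neq0 mJ)); rewrite (dot_baverage _ sf (atom_algebra aJ))//.
apply: (integrable_const_atom aJ _).2 => s Js.
by rewrite (step_mono Nn sf aJ Js Jt).
Qed.

(** On [I] the limit equals a term of the martingale, and that term is measurable for a finite
    algebra. *)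
Lemma simple_space_step f : simple_space I F f -> exists N, step (F N) f.
Proof.
move=> [f_ [[_ ce] [N fN]]]; exists N.
have [mf _ _] := ce N N (leqnn _).
have /(bmeasurable_step fbF) sf := mf.
move=> J aJ s t Js Jt.
have JI := filtration_sub (atom_algebra aJ).
have [_ fE] := fN N (leqnn _).
by rewrite -!fE; [exact: (sf J)|exact: JI|exact: JI].
Qed.

(** The martingale of cell averages. It is kept explicit because (G2) is later applied to its
    differences. From level [N] on, averaging over a cell changes nothing. *)
Lemma step_simple_martingale N f : step (F N) f ->
  simple_martingale I F (fun n t => baverage (cell (F n) t) f) f.
Proof.
move=> sf; pose f_ n t := baverage (cell (F n) t) f.
have sf_ n : step (F n) (f_ n) by exact: (step_cell (fun K => baverage K f)).
(* The conditional expectation identity, tested against [w] and summed over the atoms in [A]. *)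
have f_E w n A : F n A ->
    \int[mu]_(t in A) dot w (f_ n t) = \int[mu]_(t in A) dot w (f t).
  move=> FA.
  have iw g k K : step (F k) g -> atom (F n) K -> K `<=` A ->
      mu.-integrable K (EFin \o (dot w \o g)).
    by move=> sg /atom_algebra FK _; exact: (integrable_step (step_comp _ sg) FK).
  rewrite (Rintegral_atoms FA (fun K => iw _ _ K (sf_ n))).2.
  rewrite (Rintegral_atoms FA (fun K => iw _ _ K sf)).2.
  apply: eq_fbigr => K; rewrite in_fset_set; last exact: (finite_atoms_in fbF).
  move=> /set_mem[aK _] _; rewrite -(dot_baverage w sf (atom_algebra aK) (atom_gt0 aK)).
  apply: (integrable_const_atom aK _).2 => t Kt.
  by rewrite /= /f_ -(atom_cell fbF aK Kt).
have L1f n : in_L1 I (f_ n).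
  have [] := step_simple_function (sf_ n) (filtration_I 0).
  by split.
split; last first.
  exists N => n Nn; have f_f k t : (N <= k)%N -> I t -> f_ k t = f t.
    move=> Nk It; apply: (baverage_const sf Nk (cell_atom fbF It)).
    exact: cell_refl.
  split=> t It; last exact: f_f.
  by rewrite -/(f_ n.+1 t) -/(f_ n t) !f_f// (leq_trans Nn).
split; first exact: L1f.
move=> k n kn; split; [exact/(bmeasurable_step fbF)|exact: L1f|].
move=> A FA; apply: (dot_inj dotE) => w.
have FnA := filtration_mono kn FA.
have Ek := etrans (dot_bochner_integral w (sf_ k) FA) (f_E w k A FA).
have En := etrans (dot_bochner_integral w (sf_ n) FnA) (f_E w n A FnA).
exact: etrans Ek (esym En).
Qed.

Lemma step_simple_space N f : step (F N) f -> simple_space I F f.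
Proof.
move=> /step_simple_martingale.
by exists (fun n t => baverage (cell (F n) t) f).
Qed.

End filtration.

(** * Conditional expectation projected onto a finite-dimensional subspace *)

Section projection.
Context {R : realType} {H : completeNormedModType R} (dot : {dot H for idfun}).
Hypothesis dotE : forall x : H, `|x| ^+ 2 = dot x x.
Local Notation mu := (@lebesgue_measure R).
Local Notation m A := (fine (mu A)).
Variables (I : set R) (delta : R) (F : nat -> set (set R)).
Hypotheses (mI : measurable I) (Ioo : (mu I < +oo)%E) (I0 : (0 < mu I)%E).
Hypotheses (delta0 : 0 < delta) (regF : regular_filtration I delta F).
Local Notation fbF := (filtration_algebra regF _).
Implicit Types (A J K Q : set R).

Variable W : set H.
Hypothesis finW : exists s : seq H, W = span [set` s].

Lemma W_subspace : subspace W.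
Proof. by have [s ->] := finW; exact: subspace_span. Qed.

Lemma W_span D : D `<=` W -> span D `<=` W.
Proof. by move=> DW v; apply; [exact: W_subspace|exact: DW]. Qed.

Lemma W_B u v : W u -> W v -> W (u - v).
Proof. by have [s ->] := finW; exact: spanB. Qed.

Variable h : R -> H.
Hypothesis ih : forall v, mu.-integrable I (EFin \o (fun t => dot v (h t))).

Lemma integrable_sub_dot n A v : F n A ->
  mu.-integrable A (EFin \o (fun t => dot v (h t))).
Proof.
move=> FA; apply: integrableS (ih v) => //.
- exact: (filtration_measurable regF FA).
- exact: (filtration_sub regF FA).
Qed.

(** The vector [ha J] is the projection onto [W] of the average of [h] on [J], obtained as the Riesz
    representative of the averaged functional. It is chosen once per set, independently of the
    levels at which the set is an atom. *)
Lemma exists_average : exists ha : set R -> H, forall n J, atom (F n) J ->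
  W (ha J) /\ forall v, W v -> m J * dot v (ha J) = \int[mu]_(t in J) dot v (h t).
Proof.
have [s WE] := finW.
suff /choice : forall J : set R, exists w, forall n, atom (F n) J ->
  W w /\ forall v, W v -> m J * dot v w = \int[mu]_(t in J) dot v (h t).
  by move=> [ha haP]; exists ha => n J; exact: haP.
move=> J; have [[n aJ]|nJ] := pselect (exists n, atom (F n) J); last first.
  by exists 0 => n aJ; exfalso; apply: nJ; exists n.
have FJ := atom_algebra aJ; have mJ := filtration_measurable regF FJ.
have iJ v := integrable_sub_dot v FJ.
have [|w Ww wE] := @span_riesz_seq _ _ dot dotE s
    (fun v => (m J)^-1 * \int[mu]_(t in J) dot v (h t)).
  move=> a u v; rewrite mulrCA -mulrDr; congr (_ * _).
  rewrite -RintegralZl// -RintegralD//; last exact: integrableZR.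
  by apply: eq_Rintegral => t _; rewrite dotDl dotZl.
exists w => _ _; rewrite WE; split=> // v /wE ->.
by rewrite mulrA divff ?mul1r// gt_eqF// (atom_gt0 Ioo I0 delta0 regF aJ).
Qed.

Variable ha : set R -> H.
Hypothesis haW : forall n J, atom (F n) J -> W (ha J).
Hypothesis haE : forall n J v, atom (F n) J -> W v ->
  m J * dot v (ha J) = \int[mu]_(t in J) dot v (h t).
Variable N : nat.

(** The function [hN] of the overview: conditional expectation given [F N], then projection onto
    [W]. *)
Definition hproj t := ha (cell (F N) t).

Lemma step_hproj : step (F N) hproj.
Proof. exact: (step_cell regF). Qed.

Lemma hprojW t : I t -> W (hproj t).
Proof. by move=> It; apply: haW; exact: (cell_atom fbF It). Qed.

(** On each atom of [F N] the function [phi] is a fixed vector of [W], against which [h] and its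
    projected average have the same integral. *)
Lemma Rintegral_hproj n A phi : (n <= N)%N -> F n A -> step (F N) phi ->
    (forall t, A t -> W (phi t)) ->
  mu.-integrable A (EFin \o (fun t => dot (phi t) (h t))) /\
  \int[mu]_(t in A) dot (phi t) (h t) = \int[mu]_(t in A) dot (phi t) (hproj t).
Proof.
move=> nN FnA sphi phiW; have FA := filtration_mono regF nN FnA.
have iphi K : atom (F N) K -> K `<=` A ->
    mu.-integrable K (EFin \o (fun t => dot (phi t) (h t))) /\
    \int[mu]_(t in K) dot (phi t) (h t) =
    \int[mu]_(t in K) dot (phi t) (hproj t).
  move=> aK KA; have [_ [s Ks] _] := aK; have FK := atom_algebra aK.
  have phiE t : K t -> phi t = phi s by move=> Kt; exact: sphi Kt Ks.
  split.
    apply: eq_integrable (integrable_sub_dot (phi s) FK) => //.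
      exact: (filtration_measurable regF FK).
    by move=> t /set_mem /phiE /= ->.
  transitivity (\int[mu]_(t in K) dot (phi s) (h t)).
    by apply: eq_Rintegral => t /set_mem /phiE ->.
  rewrite -(haE aK); last exact: phiW (KA _ Ks).
  apply/esym/(integrable_const_atom mI Ioo regF aK _).2 => t Kt.
  by rewrite phiE// /hproj -(atom_cell fbF aK Kt).
have iphi' K : atom (F N) K -> K `<=` A ->
    mu.-integrable K (EFin \o (fun t => dot (phi t) (hproj t))).
  move=> aK KA.
  apply: (integrable_step (N := N) mI Ioo regF _ (atom_algebra aK)).
  by move=> J aJ s t Js Jt; rewrite (sphi J aJ s t)// (step_hproj aJ Js Jt).
have [iA ->] := Rintegral_atoms regF FA (fun K aK KA => (iphi K aK KA).1).
rewrite (Rintegral_atoms regF FA iphi').2; split=> //.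
apply: eq_fbigr => K; rewrite in_fset_set; last exact: (finite_atoms_in fbF).
by move=> /set_mem[aK KA] _; exact: (iphi K aK KA).2.
Qed.

(** The tower property. Both sides lie in [W], so pairing with their difference is allowed in [haE]
    and shows that its norm is 0. *)
Lemma baverage_hproj n J : (n <= N)%N -> atom (F n) J -> baverage J hproj = ha J.
Proof.
move=> nN aJ; have FJ := atom_algebra aJ.
have mJ := atom_gt0 Ioo I0 delta0 regF aJ.
have WB : W (baverage J hproj - ha J).
  apply: W_B; last exact: haW aJ.
  apply: W_span (span_baverage dotE mI Ioo regF step_hproj FJ).
  by move=> _ [t Jt <-]; apply: hprojW; exact: (filtration_sub regF FJ).
apply/eqP; rewrite -subr_eq0 -normr_eq0 -sqrf_eq0 dotE dotBr subr_eq0.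
apply/eqP/(mulfI (lt0r_neq0 mJ)).
rewrite (dot_baverage dotE mI Ioo regF _ step_hproj FJ mJ) (haE aJ)//.
by apply/esym/(Rintegral_hproj nN FJ _ (fun _ _ => WB)).2.
Qed.

(** An integral, not an average: no division by the length of [J]. *)
Definition variance J := \int[mu]_(t in J) `|hproj t - ha J| ^+ 2.

(** The law of total variance: on a child [Q], write [hproj - ha J] as [(hproj - ha Q) + w] with [w]
    constant; the cross term has integral 0. *)
Lemma variance_children n J : (n < N)%N -> atom (F n) J ->
  variance J = \sum_(Q <- fset_set (atoms_in (F n.+1) J))
    (variance Q + m Q * `|ha Q - ha J| ^+ 2).
Proof.
move=> nN aJ; have FJ := atom_algebra aJ.
have FJ' := filtration_mono regF (leqnSn n) FJ.
have sB w : step (F N) (fun t => hproj t - w).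
  exact: (step_comp (fun x => x - w) step_hproj).
have iS k A (u : R -> R) : step (F N) u -> F k A -> mu.-integrable A (EFin \o u).
  exact: (integrable_step mI Ioo regF).
rewrite /variance (Rintegral_atoms regF FJ' _).2; last first.
  move=> K /atom_algebra FK _; apply: iS FK.
  exact: (step_comp (fun x => `|x| ^+ 2) (sB _)).
apply: eq_fbigr => Q; rewrite in_fset_set; last exact: (finite_atoms_in fbF).
move=> /set_mem[aQ QJ] _; have FQ := atom_algebra aQ.
have mQ := filtration_measurable regF FQ.
have mQ0 := atom_gt0 Ioo I0 delta0 regF aQ.
set w := ha Q - ha J.
transitivity (\int[mu]_(t in Q) (`|hproj t - ha Q| ^+ 2 +
    (2 * dot w (hproj t) + (`|w| ^+ 2 - 2 * dot w (ha Q))))).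
  apply: eq_Rintegral => t _.
  have -> : hproj t - ha J = (hproj t - ha Q) + w by rewrite subrKA.
  by rewrite (sqrnormD dotE) (dotC dot _ w) dotBr; ring.
have i1 : mu.-integrable Q (EFin \o (fun t => `|hproj t - ha Q| ^+ 2)).
  by apply: iS FQ; exact: (step_comp (fun x => `|x| ^+ 2) (sB _)).
have i2 : mu.-integrable Q (EFin \o (fun t => 2 * dot w (hproj t))).
  by apply: iS FQ; exact: (step_comp (fun x => 2 * dot w x) step_hproj).
have i2' : mu.-integrable Q (EFin \o (fun t => dot w (hproj t))).
  by apply: iS FQ; exact: (step_comp (fun x => dot w x) step_hproj).
have i3 : mu.-integrable Q (EFin \o cst (`|w| ^+ 2 - 2 * dot w (ha Q))).
  exact: integrable_cst mQ (filtration_lty mI Ioo regF FQ).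
rewrite RintegralD//; last exact: integrableDR.
rewrite RintegralD// Rintegral_cst// RintegralZl//.
rewrite -(dot_baverage dotE mI Ioo regF _ step_hproj FQ mQ0).
by rewrite (baverage_hproj nN aQ); ring.
Qed.

End projection.

(** * Jensen's inequality for powers *)

Section jensen.
Context {R : realType}.
Local Notation mu := (@lebesgue_measure R).

(** The graph of the power [r] lies above its tangent at [a]. This is Young's inequality with
    exponents [r] and [r / (r - 1)]; [r = 1] is treated apart. *)
Lemma powR_tangent (r a u : R) : 1 <= r -> 0 <= a -> 0 <= u ->
  r * (u * a `^ (r - 1)) <= u `^ r + (r - 1) * a `^ r.
Proof.
move=> r1 a0 u0; have [->|rN1] := eqVneq r 1.
  by rewrite subrr powRr0 mul0r addr0 !mul1r mulr1 powRr1.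
have {rN1}r1 : 1 < r by rewrite lt_def rN1.
have r0 : 0 < r by rewrite (lt_trans _ r1).
have r10 : 0 < r - 1 by rewrite subr_gt0.
have := @conjugate_powR _ u (a `^ (r - 1)) r (r / (r - 1)) u0 (powR_ge0 _ _) r0
  (divr_gt0 r0 r10).
rewrite -powRrM [(r - 1) * _]mulrCA divff ?gt_eqF// mulr1 invf_div.
have -> : r^-1 + (r - 1) / r = 1.
  by rewrite mulrBl divff ?gt_eqF// mul1r addrC subrK.
move=> /(_ erefl); rewrite -(ler_pM2l r0) => /le_trans; apply.
have rN0 : r != 0 by rewrite gt_eqF.
rewrite (_ : r * _ = u `^ r + (r - 1) * a `^ r)//.
by field.
Qed.

(** Integrate the tangent inequality at the mean [a] of [u]. *)
Lemma jensen_powR (A : set R) (r : R) (u : R -> R) : measurable A ->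
    (mu A < +oo)%E -> 0 < fine (mu A) -> 1 <= r -> (forall t, A t -> 0 <= u t) ->
    mu.-integrable A (EFin \o u) -> mu.-integrable A (EFin \o (fun t => u t `^ r)) ->
  ((\int[mu]_(t in A) u t) / fine (mu A)) `^ r <=
  (\int[mu]_(t in A) (u t `^ r)) / fine (mu A).
Proof.
move=> mA Aoo A0 r1 u0 iu iur; set M := fine _ in A0 *.
set a := _ / M; have a0 : 0 <= a.
  by rewrite divr_ge0 ?(ltW A0)//; exact: Rintegral_ge0.
have uE : \int[mu]_(t in A) u t = M * a by rewrite mulrC divfK ?gt_eqF.
have r0 : 0 < r by rewrite (lt_le_trans _ r1).
rewrite ler_pdivlMr//.
have ic : mu.-integrable A (EFin \o cst ((r - 1) * a `^ r)).
  exact: integrable_cst.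
have il : mu.-integrable A (EFin \o (fun t => (r * a `^ (r - 1)) * u t)).
  exact: integrableZR.
have : \int[mu]_(t in A) ((r * a `^ (r - 1)) * u t) <=
    \int[mu]_(t in A) (u t `^ r + (r - 1) * a `^ r).
  apply: le_Rintegral => //; first exact: integrableDR.
  move=> t At; apply: le_trans (powR_tangent r1 a0 (u0 t At)).
  by rewrite mulrAC mulrA mulrAC.
rewrite RintegralZl// RintegralD// Rintegral_cst// uE -/M.
have -> : r * a `^ (r - 1) * (M * a) = r * M * (a * a `^ (r - 1)) by ring.
by rewrite mulr_powRB1//; lra.
Qed.

End jensen.

(** * Bellman points on the tree of atoms and downward induction *)

Section tree.
Context {R : realType} {H : completeNormedModType R} (dot : {dot H for idfun}).
Hypothesis dotE : forall x : H, `|x| ^+ 2 = dot x x.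
Local Notation mu := (@lebesgue_measure R).
Local Notation m A := (fine (mu A)).
Variables (I : set R) (delta : R) (F : nat -> set (set R)).
Hypotheses (mI : measurable I) (Ioo : (mu I < +oo)%E) (I0 : (0 < mu I)%E).
Hypotheses (delta0 : 0 < delta) (regF : regular_filtration I delta F).
Local Notation fbF := (filtration_algebra regF _).
Implicit Types (A J K Q : set R).

Variable W : set H.
Hypothesis finW : exists s : seq H, W = span [set` s].
Variable h : R -> H.
Hypothesis ih : forall v, mu.-integrable I (EFin \o (fun t => dot v (h t))).
Variable ha : set R -> H.
Hypothesis haW : forall n J, atom (F n) J -> W (ha J).
Hypothesis haE : forall n J v, atom (F n) J -> W v ->
  m J * dot v (ha J) = \int[mu]_(t in J) dot v (h t).
Variable N : nat.
Variable f : R -> H.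
Hypotheses (sf : step (F N) f) (fW : forall t, I t -> W (f t)).
Variables (p q : R) (g : R -> R).
Hypotheses (p1 : 1 <= p) (q2 : 2 <= q).
Hypothesis ig2 : mu.-integrable I (EFin \o (fun t => g t ^+ 2)).
Hypothesis igq : mu.-integrable I (EFin \o (fun t => `|g t| `^ q)).
Local Notation var := (variance F ha N).
Hypothesis var_le : forall n J, (n <= N)%N -> atom (F n) J ->
  var J <= \int[mu]_(t in J) g t ^+ 2.

(** The point [x_J] of the overview. *)
Definition bellman_point J : H * R * R * R :=
  (baverage J f, (\int[mu]_(t in J) g t ^+ 2 - var J) / m J,
   (\int[mu]_(t in J) (`|f t| `^ p)) / m J,
   (\int[mu]_(t in J) (`|g t| `^ q)) / m J).

Let integrableF n A u : F n A -> mu.-integrable I (EFin \o u) ->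
  mu.-integrable A (EFin \o u).
Proof.
move=> FA; apply: integrableS => //; first exact: (filtration_measurable regF FA).
exact: (filtration_sub regF FA).
Qed.

Let iS k A (u : R -> R) : step (F N) u -> F k A -> mu.-integrable A (EFin \o u).
Proof. exact: (integrable_step mI Ioo regF). Qed.

Lemma variance_ge0 J : 0 <= var J.
Proof. by apply: Rintegral_ge0 => t _; exact: sqr_ge0. Qed.

Lemma bellman_point_Omega n J : (n <= N)%N -> atom (F n) J ->
  Omega p q (bellman_point J).
Proof.
move=> nN aJ; have FJ := atom_algebra aJ.
have mJ := filtration_measurable regF FJ.
have Joo := filtration_lty mI Ioo regF FJ.
have J0 := atom_gt0 Ioo I0 delta0 regF aJ.
have x20 : 0 <= (\int[mu]_(t in J) g t ^+ 2 - var J) / m J.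
  by rewrite divr_ge0 ?(ltW J0)// subr_ge0 (var_le nN).
have if_ : mu.-integrable J (EFin \o (fun t => `|f t|)).
  exact: iS (step_comp (fun x : H => `|x|) sf) FJ.
split=> //.
- by rewrite divr_ge0 ?(ltW J0)//; apply: Rintegral_ge0 => t _; exact: powR_ge0.
- by rewrite divr_ge0 ?(ltW J0)//; apply: Rintegral_ge0 => t _; exact: powR_ge0.
- apply: le_trans (jensen_powR mJ Joo J0 p1 (fun t _ => normr_ge0 (f t)) if_ _).
    apply: ge0_ler_powR; rewrite ?nnegrE ?(le_trans _ p1)//.
      by rewrite divr_ge0 ?(ltW J0)//; exact: Rintegral_ge0.
    (* The norm of the average [a] is at most the average of the norm: pair [a] with itself and use
       Cauchy-Schwarz under the integral. *)
    rewrite ler_pdivlMr//; set a := baverage J f.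
    have [->|a0] := eqVneq a 0; first by rewrite normr0 mul0r Rintegral_ge0.
    have {}a0 : 0 < `|a| by rewrite normr_gt0.
    rewrite -(ler_pM2l a0) mulrA -expr2 dotE mulrC.
    rewrite (dot_baverage dotE mI Ioo regF _ sf FJ J0) -RintegralZl//.
    apply: le_Rintegral => //.
    + exact: iS (step_comp (fun x => dot a x) sf) FJ.
    + exact: integrableZR.
    + by move=> t _; exact: (ler_dot dotE).
  exact: iS (step_comp (fun x : H => `|x| `^ p) sf) FJ.
(* Jensen with exponent [q / 2] for [g ^+ 2], then squaring. Dropping the variance only increases
   the second entry. *)
- have q21 : 1 <= q / 2 by rewrite ler_pdivlMr// mul1r.
  have gE t : (g t ^+ 2) `^ (q / 2) = `|g t| `^ q.
    rewrite -real_normK ?num_real// -powR_mulrn// -powRrM.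
    by rewrite mulrC divfK.
  have gqE : \int[mu]_(t in J) (`|g t| `^ q) =
      \int[mu]_(t in J) ((g t ^+ 2) `^ (q / 2)).
    by apply: eq_Rintegral => t _; rewrite gE.
  have := jensen_powR mJ Joo J0 q21 (fun t _ => sqr_ge0 (g t))
    (integrableF FJ ig2) _.
  rewrite -gqE => jg.
  set a := _ / m J in jg.
  have a0 : 0 <= a.
    by rewrite divr_ge0 ?(ltW J0)//; apply: Rintegral_ge0 => t _; exact: sqr_ge0.
  apply: (@le_trans _ _ (a `^ q)).
    apply: ge0_ler_powR; rewrite ?nnegrE ?(le_trans _ q2)//.
    by rewrite ler_wpM2r ?invr_ge0 ?(ltW J0)// gerBl variance_ge0.
  have -> : a `^ q = (a `^ (q / 2)) ^+ 2.
    by rewrite -powR_mulrn ?powR_ge0// -powRrM divfK.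
  rewrite lerXn2r ?nnegrE ?powR_ge0//.
    by rewrite divr_ge0 ?(ltW J0)//; apply: Rintegral_ge0 => t _; exact: powR_ge0.
  apply: jg; apply: eq_integrable (integrableF FJ igq) => // t _ /=.
  by rewrite gE.
Qed.

Let sum_atoms n J (u : R -> R) : atom (F n) J -> mu.-integrable I (EFin \o u) ->
  \int[mu]_(t in J) u t =
  \sum_(Q <- fset_set (atoms_in (F n.+1) J)) \int[mu]_(t in Q) u t.
Proof.
move=> aJ iu; have FJ := filtration_mono regF (leqnSn n) (atom_algebra aJ).
apply: (Rintegral_atoms regF FJ _).2 => K /atom_algebra FK _.
exact: integrableF FK iu.
Qed.

(** For [J = I] and [h] representing [T^* g], this is the integral of [g] times [T (f - <f>)], the
    quantity to be bounded. *)
Definition defect J := \int[mu]_(t in J) dot (f t - baverage J f) (h t).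

Lemma baverageW n J : atom (F n) J -> W (baverage J f).
Proof.
move=> /atom_algebra FJ.
apply: (W_span finW _) (span_baverage dotE mI Ioo regF sf FJ).
by move=> _ [t Jt <-]; apply: fW; exact: (filtration_sub regF FJ).
Qed.

Lemma integrable_dot_sub n A w : (n <= N)%N -> F n A -> W w ->
  mu.-integrable A (EFin \o (fun t => dot (f t - w) (h t))).
Proof.
move=> nN FA Ww.
apply: (Rintegral_hproj (phi := fun t => f t - w) mI Ioo regF ih haE nN FA _ _).1.
  exact: (step_comp (fun x => x - w) sf).
by move=> t At; apply: (W_B finW) => //; apply: fW; exact: (filtration_sub regF FA).
Qed.

(** On a child [Q], [f - <f>_J] is [f - <f>_Q] plus the constant [<f>_Q - <f>_J]. The constant lies
    in [W], so [ha Q] may replace [h] there. *)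
Lemma defect_children n J : (n < N)%N -> atom (F n) J ->
  defect J = \sum_(Q <- fset_set (atoms_in (F n.+1) J))
    (m Q * dot (baverage Q f - baverage J f) (ha Q) + defect Q).
Proof.
move=> nN aJ; have FJ := filtration_mono regF (leqnSn n) (atom_algebra aJ).
have WJ := baverageW aJ.
rewrite /defect (Rintegral_atoms regF FJ _).2; last first.
  by move=> K /atom_algebra FK _; exact: (integrable_dot_sub nN FK WJ).
apply: eq_fbigr => Q; rewrite in_fset_set; last exact: (finite_atoms_in fbF).
move=> /set_mem[aQ QJ] _; have FQ := atom_algebra aQ; have WQ := baverageW aQ.
have mQ := filtration_measurable regF FQ.
rewrite (haE aQ); last exact: (W_B finW).
rewrite -RintegralD//.
- by apply: eq_Rintegral => t _; rewrite -dotDl [_ - _ + _]addrC subrKA.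
- exact: (integrable_sub_dot mI regF ih _ FQ).
- exact: (integrable_dot_sub nN FQ WQ).
Qed.

Variable B : H * R * R * R -> R.
Hypothesis KB : classK p q delta B.

Lemma defect_le n J : (n <= N)%N -> atom (F n) J ->
  defect J <= m J * B (bellman_point J).
Proof.
(* The induction runs on [k], the number of levels between [n] and [N]. *)
move=> nN; have [k kE] : exists k, (k + n = N)%N by exists (N - n)%N; rewrite subnK.
elim: k n kE J {nN} => [|k IH] n kE J aJ; have FJ := atom_algebra aJ.
  have J0 := atom_gt0 Ioo I0 delta0 regF aJ.
  have nN : n = N by rewrite -kE add0n.
  have fJ t : J t -> baverage J f = f t.
    by apply: (baverage_const dotE mI Ioo I0 delta0 regF sf _ aJ); rewrite nN.
  (* On an atom of level [N], [f] is constant: the defect vanishes and the first and third entries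
     of [x_J] satisfy the equality required in (B1). *)
  have -> : defect J = 0.
    rewrite -[RHS](mulr0 (m J)).
    apply: (integrable_const_atom mI Ioo regF aJ _).2 => t Jt.
    by rewrite (fJ t Jt) subrr dot0l.
  have [_ B0 _] := KB.
  apply: mulr_ge0; first exact: ltW.
  apply: B0; first by apply: (bellman_point_Omega _ aJ); rewrite nN.
  rewrite (integrable_const_atom (c := `|baverage J f| `^ p) mI Ioo regF aJ _).2.
    by rewrite mulrAC divff ?mul1r// gt_eqF.
  by move=> t /fJ ->.
have nN : (n < N)%N by rewrite -kE addSn ltnS leq_addl.
have {}kE : (k + n.+1 = N)%N by rewrite addnS.
(* The children of [J] are indexed by an ordinal, as in (B2). *)
pose s : seq (set R) := fset_set (atoms_in (F n.+1) J).
have sP Q : Q \in s -> atom (F n.+1) Q /\ Q `<=` J.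
  by rewrite in_fset_set; [move=> /set_mem|exact: (finite_atoms_in fbF)].
pose Q_ (i : 'I_(size s)) := nth set0 s i.
have aQ i : atom (F n.+1) (Q_ i) by have [] := sP _ (mem_nth set0 (ltn_ord i)).
have QJ i : Q_ i `<=` J by have [] := sP _ (mem_nth set0 (ltn_ord i)).
have sumE (V : nmodType) (E : set R -> V) : \sum_i E (Q_ i) = \sum_(Q <- s) E Q.
  by rewrite (big_nth set0) big_mkord.
have J0 := atom_gt0 Ioo I0 delta0 regF aJ.
have Q0 i := atom_gt0 Ioo I0 delta0 regF (aQ i).
have divK (x y : R) : 0 < y -> y * (x / y) = x.
  by move=> y0; rewrite mulrCA divff ?mulr1// gt_eqF.
rewrite (defect_children nN aJ) -/s -sumE.
have := @bellman_step _ _ dot dotE p q delta B _ (m J) (fun i => m (Q_ i))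
  (baverage J f) (ha J) (fun i => baverage (Q_ i) f) (fun i => ha (Q_ i))
  _ _ _ _ _ _ KB delta0 J0 _ _ (bellman_point_Omega (ltnW nN) aJ)
  (fun i => bellman_point_Omega nN (aQ i)).
have FJ1 := filtration_mono regF (leqnSn n) FJ.
rewrite -/(bellman_point J) => step_le.
apply: le_trans (step_le _ _ _ _ _ _) => {step_le}.
- rewrite -big_split/= ler_sum// => i _; rewrite lerD2l.
  exact: IH kE _ (aQ i).
- by move=> i; have [_ _ _ reg] := regF; exact: reg aJ (aQ i) (QJ i).
(* Additivity of length, from integrating the constant 1. *)
- rewrite (sumE _ (fun Q => m Q)).
  have i1 : mu.-integrable I (EFin \o cst 1) by exact: integrable_cst.
  have := sum_atoms aJ i1; rewrite Rintegral_cst ?mul1r => [->|]; last first.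
    exact: (filtration_measurable regF FJ).
  rewrite !big_seq; apply: eq_bigr => Q /sP[/atom_algebra FQ _].
  by rewrite Rintegral_cst ?mul1r//; exact: (filtration_measurable regF FQ).
- rewrite (sumE _ (fun Q => m Q *: baverage Q f)).
  apply: (dot_inj dotE) => w; rewrite dotZr dot_sumr.
  rewrite (dot_baverage dotE mI Ioo regF w sf FJ J0).
  have iw : mu.-integrable I (EFin \o (fun t => dot w (f t))).
    exact: iS (step_comp (fun x => dot w x) sf) (filtration_I regF 0).
  rewrite (sum_atoms aJ iw) !big_seq; apply: eq_bigr => Q /sP[aQ' _].
  rewrite dotZr (dot_baverage dotE mI Ioo regF w sf (atom_algebra aQ'))//.
  exact: (atom_gt0 Ioo I0 delta0 regF aQ').
(* By the law of total variance, the second entry is the only one that increases on passing to the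
   children. *)
- rewrite divK// (sum_atoms aJ ig2).
  rewrite (variance_children dotE mI Ioo I0 delta0 regF finW ih haW haE nN aJ).
  rewrite big_split/= opprD addrA (sumE _ (fun Q => m Q * `|ha Q - ha J| ^+ 2)).
  rewrite subrK -sumrB -sumE; apply: eq_bigr => i _; exact: divK.
- rewrite divK// (sum_atoms aJ); last first.
    exact: iS (step_comp (fun x : H => `|x| `^ p) sf) (filtration_I regF 0).
  by rewrite -sumE; apply: eq_bigr => i _; exact: divK.
- rewrite divK// (sum_atoms aJ igq).
  by rewrite -sumE; apply: eq_bigr => i _; exact: divK.
Qed.

End tree.

(** * Square-integrable functions *)

Section L2.
Context {R : realType} {V : completeNormedModType R}.
Local Notation mu := (@lebesgue_measure R).
Implicit Types (A : set R) (f : R -> V).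

Lemma L2norm_lty A f :
  (L2norm A f < +oo)%E = (\int[mu]_(t in A) (`|f t| ^+ 2)%:E < +oo)%E.
Proof.
apply/idP/idP; first by apply: lty_poweRy; rewrite invr_neq0.
exact: poweR_lty.
Qed.

Lemma le_L2norm (U : completeNormedModType R) A f (g : R -> U) :
  (L2norm A f <= L2norm A g)%E ->
  (\int[mu]_(t in A) (`|f t| ^+ 2)%:E <= \int[mu]_(t in A) (`|g t| ^+ 2)%:E)%E.
Proof.
have sqr_ge0E (W : completeNormedModType R) (k : R -> W) :
    (0 <= \int[mu]_(t in A) (`|k t| ^+ 2)%:E)%E.
  by apply: integral_ge0 => t _; rewrite lee_fin sqr_ge0.
have sqE (x : \bar R) : (0 <= x)%E -> ((x `^ 2^-1) `^ 2 = x)%E.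
  by move=> x0; rewrite -poweRrM mulVf// poweRe1.
move=> fg; rewrite -[leLHS]sqE// -[leRHS]sqE//.
by apply: gt0_ler_poweR => //; rewrite in_itv/= leey poweR_ge0.
Qed.

Lemma integrable_sqrnorm A f : measurable A -> bmeasurable measurable A f ->
  (L2norm A f < +oo)%E -> mu.-integrable A (EFin \o (fun t => `|f t| ^+ 2)).
Proof.
move=> mA mf; rewrite L2norm_lty => foo; apply/integrableP; split.
  apply/measurable_EFinP.
  apply: (bmeasurable_comp (phi := fun x => `|x| ^+ 2)) => // x.
  apply: (continuous_comp (f := fun y : V => `|y|) (g := fun y : R => y ^+ 2)).
    exact: norm_continuous.
  exact: exprn_continuous.
under eq_integral do rewrite gee0_abs ?lee_fin ?sqr_ge0//.
exact: foo.
Qed.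

(** [|u v|] is at most [u ^+ 2 + v ^+ 2]. *)
Lemma integrable_mul_sqr A (u v : R -> R) : measurable A ->
  measurable_fun A u -> measurable_fun A v ->
  mu.-integrable A (EFin \o (fun t => u t ^+ 2)) ->
  mu.-integrable A (EFin \o (fun t => v t ^+ 2)) ->
  mu.-integrable A (EFin \o (fun t => u t * v t)).
Proof.
move=> mA mu_ mv iu iv.
apply: (le_integrable_real mA _ _ (integrableDR mA iu iv)).
  exact: measurable_funM.
move=> t _; rewrite normrM -(real_normK (num_real (u t))).
rewrite -(real_normK (num_real (v t))).
have := sqr_ge0 (`|u t| - `|v t|); have := sqr_ge0 `|u t|.
have := sqr_ge0 `|v t|.
by rewrite sqrrB; move: (`|u t|) (`|v t|) => x y; lra.
Qed.

Lemma measurable_fun_bmeasurable A (u : R -> R) :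
  measurable A -> measurable_fun A u -> bmeasurable measurable A u.
Proof. by move=> mA mu_ U oU; apply: mu_ => //; exact: open_measurable. Qed.

Lemma bmeasurable_measurable_fun A (u : R -> R) :
  measurable A -> bmeasurable measurable A u -> measurable_fun A u.
Proof.
by move=> mA mu_; apply: (bmeasurable_comp (phi := id) mA mu_ _) => x; exact: cvg_id.
Qed.

End L2.

(** * The operator and its adjoint on step functions *)

Section adjoint.
Context {R : realType} {H : completeNormedModType R} (dot : {dot H for idfun}).
Hypothesis dotE : forall x : H, `|x| ^+ 2 = dot x x.
Local Notation mu := (@lebesgue_measure R).
Local Notation m A := (fine (mu A)).
Variables (I : set R) (delta : R) (F : nat -> set (set R)).
Hypotheses (mI : measurable I) (Ioo : (mu I < +oo)%E) (I0 : (0 < mu I)%E).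
Hypotheses (delta0 : 0 < delta) (regF : regular_filtration I delta F).
Local Notation fbF := (filtration_algebra regF _).
Implicit Types (A J K Q : set R).

Lemma Finfty_measurable A : Finfty I F A -> measurable A.
Proof.
move=> FA; apply: (FA measurable); split.
  split=> //; first by move=> B mB; exact: measurableD.
  by move=> B_ mB_; exact: bigcupT_measurable.
by move=> B [n _ FB]; exact: (filtration_measurable regF FB).
Qed.

Lemma filtration_Finfty n : F n `<=` Finfty I F.
Proof. by move=> A FA G [_ FG]; apply: FG; exists n. Qed.

Variables (T : (R -> H) -> R -> R) (g : R -> R) (h : R -> H).
Hypotheses (TG : classG I F T) (g2 : in_L2 measurable I g).
Hypothesis adjT : is_adjoint dot I F T g h.

Lemma integrable_g : mu.-integrable I (EFin \o (fun t => g t ^+ 2)).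
Proof.
have [mg goo] := g2; apply: eq_integrable (integrable_sqrnorm mI mg goo) => //.
by move=> t _ /=; rewrite real_normK ?num_real.
Qed.

Lemma bmeasurable_h : bmeasurable measurable I h.
Proof. by have [[mh _] _] := adjT; move=> U /mh; exact: Finfty_measurable. Qed.

Lemma integrable_h : mu.-integrable I (EFin \o (fun t => `|h t| ^+ 2)).
Proof.
by have [[_ hoo] _] := adjT; exact: (integrable_sqrnorm mI bmeasurable_h hoo).
Qed.

(** By Cauchy-Schwarz the integrand is dominated by [|v| ^+ 2 + |h| ^+ 2], and [I] has finite
    length. *)
Lemma integrable_dot_h v : mu.-integrable I (EFin \o (fun t => dot v (h t))).
Proof.
have i1 : mu.-integrable I (EFin \o cst (`|v| ^+ 2)) by exact: integrable_cst.
apply: (le_integrable_real mI _ _ (integrableDR mI i1 integrable_h)).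
  exact: (bmeasurable_comp mI bmeasurable_h (dot_continuous dotE (w := v))).
move=> t _; apply: le_trans (ler_norm_dot dotE v (h t)) _ => /=.
have := sqr_ge0 (`|v| - `|h t|); have := sqr_ge0 `|v|; have := sqr_ge0 `|h t|.
by rewrite sqrrB; move: (`|v|) (`|h t|) => x y; lra.
Qed.

Lemma step_L2 N (phi : R -> H) : step (F N) phi ->
  mu.-integrable I (EFin \o (fun t => `|phi t| ^+ 2)).
Proof.
move=> sphi; apply: (integrable_step mI Ioo regF _ (filtration_I regF 0)).
exact: (step_comp (fun x : H => `|x| ^+ 2) sphi).
Qed.

Lemma T_step N (phi : R -> H) : step (F N) phi ->
  [/\ measurable_fun I (T phi),
      mu.-integrable I (EFin \o (fun t => T phi t ^+ 2)),
      \int[mu]_(t in I) T phi t ^+ 2 <= \int[mu]_(t in I) `|phi t| ^+ 2 &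
      (\int[mu]_(t in I) (T phi t * g t)%:E =
       \int[mu]_(t in I) (dot (phi t) (h t))%:E)%E].
Proof.
move=> sphi; have [TM _ TC _] := TG.
have ss := step_simple_space dotE mI Ioo I0 delta0 regF sphi.
have mT := TM _ ss; have bT := measurable_fun_bmeasurable mI mT.
have iphi := step_L2 sphi.
have phioo : (L2norm I phi < +oo)%E by rewrite L2norm_lty; exact: integrable_lty iphi.
have Too : (L2norm I (T phi) < +oo)%E by exact: le_lt_trans (TC _ ss) phioo.
have iT : mu.-integrable I (EFin \o (fun t => T phi t ^+ 2)).
  apply: eq_integrable (integrable_sqrnorm mI bT Too) => //.
  by move=> t _ /=; rewrite real_normK ?num_real.
split=> //.
- have -> : \int[mu]_(t in I) T phi t ^+ 2 = \int[mu]_(t in I) `|T phi t| ^+ 2.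
    by apply: eq_Rintegral => t _; rewrite real_normK ?num_real.
  apply: fine_le; last exact: le_L2norm (TC _ ss).
    exact: integrable_fin_num (integrable_sqrnorm mI bT Too).
  exact: integrable_fin_num iphi.
(* A step function is its own approximating sequence, so [T phi] is the value of the extension at
   [phi]. *)
- have [_] := adjT; apply.
  + split=> // U oU; apply: (@filtration_Finfty N).
    exact: (bmeasurable_step fbF phi).2 sphi _ oU.
  + split; first by split.
    exists (fun=> phi); split=> //.
    * under eq_fun do rewrite /L2norm.
      under eq_fun do under eq_integral do rewrite subrr normr0 expr0n.
      by rewrite integral0 poweR0r ?invr_neq0//; exact: cvg_cst.
    * under eq_fun do rewrite /L2norm.
      under eq_fun do under eq_integral do rewrite subrr normr0 expr0n.
      by rewrite integral0 poweR0r ?invr_neq0//; exact: cvg_cst.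
Qed.

(** [|h - c| ^+ 2] is at most [2 |c| ^+ 2 + 2 |h| ^+ 2], because [|h + c| ^+ 2 >= 0]. *)
Lemma integrable_center c :
  mu.-integrable I (EFin \o (fun t => `|h t - c| ^+ 2)).
Proof.
have mh := bmeasurable_h.
have ih2 := integrable_h.
have i1 : mu.-integrable I (EFin \o cst (2 * `|c| ^+ 2)) by exact: integrable_cst.
apply: (le_integrable_real mI _ _ (integrableDR mI i1 (integrableZR 2 mI ih2))).
  apply: (bmeasurable_comp (phi := fun y : H => `|y - c| ^+ 2) mI mh) => x.
  apply: (continuous_comp (f := fun y : H => `|y - c|) (g := fun y : R => y ^+ 2)).
    by apply: cvg_norm; apply: cvgB; [exact: cvg_id|exact: cvg_cst].
  exact: exprn_continuous.
move=> t _ /=; rewrite ger0_norm ?sqr_ge0//.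
have := sqr_ge0 `|h t + c|; rewrite (sqrnormB dotE) (sqrnormD dotE).
by move: (dot (h t) c) (`|h t| ^+ 2) (`|c| ^+ 2) => x y z; lra.
Qed.

End adjoint.

(** * Bounds for the variance of the projected function *)

Section variance_bound.
Context {R : realType} {H : completeNormedModType R} (dot : {dot H for idfun}).
Hypothesis dotE : forall x : H, `|x| ^+ 2 = dot x x.
Local Notation mu := (@lebesgue_measure R).
Local Notation m A := (fine (mu A)).
Variables (I : set R) (delta : R) (F : nat -> set (set R)).
Hypotheses (mI : measurable I) (Ioo : (mu I < +oo)%E) (I0 : (0 < mu I)%E).
Hypotheses (delta0 : 0 < delta) (regF : regular_filtration I delta F).
Local Notation fbF := (filtration_algebra regF _).
Implicit Types (A J K Q : set R).

Variables (T : (R -> H) -> R -> R) (g : R -> R) (h : R -> H).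
Hypotheses (TG : classG I F T) (g2 : in_L2 measurable I g).
Hypothesis adjT : is_adjoint dot I F T g h.

Variable W : set H.
Hypothesis finW : exists s : seq H, W = span [set` s].
Variable ha : set R -> H.
Hypothesis haW : forall n J, atom (F n) J -> W (ha J).
Hypothesis haE : forall n J v, atom (F n) J -> W v ->
  m J * dot v (ha J) = \int[mu]_(t in J) dot v (h t).
Variable N : nat.
Local Notation hp := (hproj F ha N).
Local Notation var := (variance F ha N).
Let ih v := integrable_dot_h dotE mI Ioo regF adjT v.
Let shp : step (F N) hp := step_hproj regF ha (N := N).

Let iS k A (u : R -> R) : step (F N) u -> F k A -> mu.-integrable A (EFin \o u).
Proof. exact: (integrable_step mI Ioo regF). Qed.

Lemma Rintegral_centered n J w : (n <= N)%N -> atom (F n) J ->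
  \int[mu]_(t in J) dot w (hp t - ha J) = 0.
Proof.
move=> nN aJ; have FJ := atom_algebra aJ.
have mJ := filtration_measurable regF FJ.
have Joo := filtration_lty mI Ioo regF FJ.
have J0 := atom_gt0 Ioo I0 delta0 regF aJ.
have i1 : mu.-integrable J (EFin \o (fun t => dot w (hp t))).
  exact: iS (step_comp (fun x => dot w x) shp) FJ.
have i2 : mu.-integrable J (EFin \o cst (dot w (ha J))) by exact: integrable_cst.
transitivity (\int[mu]_(t in J) (dot w (hp t) - dot w (ha J))).
  by apply: eq_Rintegral => t _; rewrite dotBr.
rewrite RintegralB// Rintegral_cst// -(dot_baverage dotE mI Ioo regF w shp FJ J0).
rewrite (baverage_hproj dotE mI Ioo I0 delta0 regF finW ih haW haE nN aJ).
by rewrite mulrC subrr.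
Qed.

(** The constant [ha J] may be subtracted from the second factor, since the first has mean zero on
    [J]. *)
Lemma Rintegral_dot_hproj n J : (n <= N)%N -> atom (F n) J ->
  \int[mu]_(t in J) dot (hp t - ha J) (hp t) = var J.
Proof.
move=> nN aJ; have FJ := atom_algebra aJ.
have mJ := filtration_measurable regF FJ.
have i1 : mu.-integrable J (EFin \o (fun t => `|hp t - ha J| ^+ 2)).
  exact: iS (step_comp (fun x => `|x - ha J| ^+ 2) shp) FJ.
have i2 : mu.-integrable J (EFin \o (fun t => dot (ha J) (hp t - ha J))).
  exact: iS (step_comp (fun x => dot (ha J) (x - ha J)) shp) FJ.
rewrite -[RHS]addr0 -(Rintegral_centered (ha J) nN aJ) -RintegralD//.
apply: eq_Rintegral => t _.
by rewrite dotE (dotC dot (ha J)) -dotDr subrK.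
Qed.

(** Projection does not increase variance. With [u = hp - ha I], integrate [|h - c - u| ^+ 2 >= 0]:
    the pairing of [u] with [h] is the variance, that with [c] is 0. *)
Lemma variance_le_center c : var I <= \int[mu]_(t in I) `|h t - c| ^+ 2.
Proof.
have aI := atomI I0 regF; have FI := atom_algebra aI.
pose u t := hp t - ha I.
have su : step (F N) u by exact: (step_comp (fun x => x - ha I) shp).
have Wu t : I t -> W (u t).
  by move=> It; apply: (W_B finW); [exact: (hprojW regF haW)|exact: haW aI].
have [iuh uhE] := Rintegral_hproj mI Ioo regF ih haE (leq0n N) FI su Wu.
rewrite (Rintegral_dot_hproj (leq0n N) aI) in uhE.
have iu2 : mu.-integrable I (EFin \o (fun t => `|u t| ^+ 2)).
  exact: iS (step_comp (fun x : H => `|x| ^+ 2) su) FI.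
have icu : mu.-integrable I (EFin \o (fun t => dot c (u t))).
  exact: iS (step_comp (fun x => dot c x) su) FI.
have ihc := integrable_center dotE mI Ioo regF adjT c.
have : \int[mu]_(t in I) ((2 * dot (u t) (h t) - 2 * dot c (u t)) - `|u t| ^+ 2) <=
    \int[mu]_(t in I) `|h t - c| ^+ 2.
  apply: le_Rintegral => //.
    apply: integrableBR => //.
    by apply: integrableBR => //; exact: integrableZR.
  move=> t _; have := sqr_ge0 `|(h t - c) - u t|.
  rewrite (sqrnormB dotE (h t - c)) dotBl (dotC dot (h t)).
  move: (dot (u t) (h t)) (dot c (u t)) (`|h t - c| ^+ 2) (`|u t| ^+ 2).
  by move=> a b x y; lra.
rewrite RintegralB//; last first.
  by apply: integrableBR => //; exact: integrableZR.
rewrite RintegralB//; [|exact: integrableZR|exact: integrableZR].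
rewrite !RintegralZl// uhE (Rintegral_centered c (leq0n N) aI) mulr0 subr0.
by rewrite mulr_natl mulr2n -/(var I) -addrA subrr addr0.
Qed.

Section fluctuation.
Variables (n : nat) (J : set R).
Hypotheses (nN : (n <= N)%N) (aJ : atom (F n) J).
Let FJ := atom_algebra aJ.

(** The test function to which [T] is applied in order to bound the variance on [J]. *)
Definition fluctuation t := if t \in J then hp t - ha J else 0.
Local Notation phi := fluctuation.

Let phiE A (G : H -> R) : G 0 = 0 ->
  \int[mu]_(t in A) G (phi t) = \int[mu]_(t in A `&` J) G (hp t - ha J).
Proof.
move=> G0; rewrite Rintegral_mkcondr; apply: eq_Rintegral => t _.
by rewrite patchE /phi; case: ifP.
Qed.

Lemma step_fluctuation : step (F N) phi.
Proof.
move=> K aK s t Ks Kt; rewrite /phi.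
have -> : (s \in J) = (t \in J).
  have FNJ := filtration_mono regF nN FJ.
  have st u v : K u -> K v -> J u -> J v.
    move=> Ku + Ju; rewrite (atom_cell fbF aK Ku); apply => //.
  by apply/idP/idP => /set_mem ?; apply/mem_set; [apply: (st s)|apply: (st t)].
by case: ifP => // _; rewrite (shp aK Ks Kt).
Qed.

Lemma fluctuationW t : I t -> W (phi t).
Proof.
move=> It; rewrite /phi; case: ifP => _; last exact: (W_subspace finW).1.
by apply: (W_B finW); [exact: (hprojW regF haW)|exact: haW aJ].
Qed.

(** The cell either misses [J] or contains it, and the fluctuation has mean zero on [J]. Beyond
    level [n], the cell of a point outside [J] misses [J]. *)
Lemma baverage_fluctuation k t : I t -> (k <= n)%N \/ ~ J t ->
  baverage (cell (F k) t) phi = 0.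
Proof.
move=> It knJ; apply: (dot_inj dotE) => w; rewrite dot0r.
have aK := cell_atom (filtration_algebra regF k) It; have FK := atom_algebra aK.
have K0 := atom_gt0 Ioo I0 delta0 regF aK.
apply: (mulfI (lt0r_neq0 K0)).
rewrite (dot_baverage dotE mI Ioo regF w step_fluctuation FK K0) mulr0.
rewrite phiE ?dot0r//.
have [->|->] : cell (F k) t `&` J = set0 \/ cell (F k) t `&` J = J.
- have [kn|nk] := leqP k n.
    have [_ _ minJ] := aJ; apply: minJ; last exact: subIsetr.
    exact: (algebraI fbF (filtration_mono regF kn FK) FJ).
  left; apply/seteqP; split=> // s [ts Js].
  have {knJ} NJt : ~ J t by case: knJ => //; rewrite leqNgt nk.
  have FkJ := filtration_mono regF (ltnW nk) FJ.
  by have [] := ts _ (algebraC fbF FkJ) (conj It NJt).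
- exact: Rintegral_set0.
- exact: (Rintegral_centered w nN aJ).
Qed.

Lemma T_fluctuation : {ae mu, forall t, I t -> 0 < `|T phi t| -> J t}.
Proof.
have [_ _ _ TS] := TG.
(* In (G2), [e_k] is [J] for [k > n] and empty otherwise. It is predictable: [J] belongs to [F n],
   and the first index using it is [n + 1]. *)
have := TS phi _ (fun k => if (n < k)%N then J else set0)
  (step_simple_martingale dotE mI Ioo I0 delta0 regF step_fluctuation).
move=> /(_ _ _ _)/= TS'.
have {}TS' : {ae mu, forall t, I t -> 0 < `|T phi t| ->
    exists k, (if (n < k.+1)%N then J else set0) t}.
  apply: TS'.
  - by move=> t It; apply: baverage_fluctuation => //; left.
  - by move=> k; rewrite ltnS; case: leqP => nk;
      [exact: (filtration_mono regF nk FJ)|exact: (algebra0 fbF)].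
  - move=> k t It; rewrite ltnS indicE; case: leqP => kn; last first.
      by rewrite !baverage_fluctuation ?subrr ?scaler0//; left=> //; exact: ltnW.
    have [Jt|Jt] := pselect (J t); first by rewrite mem_set// scale1r.
    by rewrite !baverage_fluctuation ?subrr ?scaler0//; right.
move: TS'; apply: filterS; first exact: (ae_filter_ringOfSetsType mu).
by move=> t Tt It /(Tt It)[k]; case: ifP.
Qed.

(** The variance equals the pairing of [T phi] with [g], hence with [g] cut off to [J], and [T] is a
    contraction. *)
Lemma variance_le : var J <= \int[mu]_(t in J) g t ^+ 2.
Proof.
have mJ := filtration_measurable regF FJ.
have sphi := step_fluctuation.
have [mT iT leT adjE] := T_step dotE mI Ioo I0 delta0 regF TG adjT sphi.
have [mg _] := g2; have {}mg := bmeasurable_measurable_fun mI mg.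
have ig := integrable_g mI g2.
have phi2E : \int[mu]_(t in I) `|phi t| ^+ 2 = var J.
  rewrite (phiE I (G := fun x => `|x| ^+ 2)) ?normr0 ?expr0n//.
  by rewrite (setIidr (filtration_sub regF FJ)).
have dotphiE : \int[mu]_(t in I) dot (phi t) (h t) = var J.
  have FI := filtration_I regF 0.
  rewrite (Rintegral_hproj mI Ioo regF ih haE (leq0n N) FI sphi fluctuationW).2.
  rewrite -(Rintegral_dot_hproj nN aJ).
  transitivity (\int[mu]_(t in I `&` J) dot (hp t - ha J) (hp t)); last first.
    by rewrite (setIidr (filtration_sub regF FJ)).
  rewrite Rintegral_mkcondr; apply: eq_Rintegral => t _; rewrite patchE /phi.
  by case: ifP => // _; rewrite dot0l.
have TgE : \int[mu]_(t in I) (T phi t * g t) = var J.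
  by rewrite -dotphiE; congr fine.
have iTg := integrable_mul_sqr mI mT mg iT ig.
have FNJ := filtration_mono regF nN FJ.
have mgJ : measurable_fun I (g \_ J).
  by apply/measurable_restrict => //; apply: measurable_funS mg.
have igJ : mu.-integrable I (EFin \o (fun t => (g \_ J) t ^+ 2)).
  apply: (le_integrable_real mI _ _ ig).
    exact: measurable_funX.
  move=> t _; rewrite patchE; case: ifP => _; first by rewrite ger0_norm ?sqr_ge0.
  by rewrite expr0n normr0 sqr_ge0.
(* Almost everywhere, [T phi] vanishes outside [J]. *)
have TgJE : \int[mu]_(t in I) (T phi t * (g \_ J) t) = var J.
  rewrite -TgE; congr fine; apply: ae_eq_integral => //.
  - by apply/measurable_EFinP; exact: measurable_funM.
  - by apply/measurable_EFinP; exact: measurable_funM.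
  move: T_fluctuation; apply: filterS.
    exact: (ae_filter_ringOfSetsType mu).
  move=> t TJ It; rewrite patchE; case: ifPn => // tJ.
  have [->|T0] := eqVneq (T phi t) 0; first by rewrite !mul0r.
  by move: tJ; rewrite mem_set//; apply: TJ => //; rewrite normr_gt0.
have gJE : \int[mu]_(t in I) (g \_ J) t ^+ 2 = \int[mu]_(t in J) g t ^+ 2.
  rewrite -[in RHS](setIidr (filtration_sub regF FJ)) Rintegral_mkcondr.
  apply: eq_Rintegral => t _; rewrite !patchE; case: ifP => // _.
  by rewrite expr0n.
(* Integrating [2 a b <= a ^+ 2 + b ^+ 2] bounds twice the variance by the squared norm of [T phi]
   plus the integral of [g ^+ 2] on [J]; contraction bounds the former by the variance, which then
   cancels once. *)
have : \int[mu]_(t in I) (2 * (T phi t * (g \_ J) t)) <=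
    \int[mu]_(t in I) (T phi t ^+ 2 + (g \_ J) t ^+ 2).
  have iTgJ := integrable_mul_sqr mI mT mgJ iT igJ.
  apply: le_Rintegral => //; [exact: integrableZR|exact: integrableDR|].
  move=> t _; have := sqr_ge0 (T phi t - (g \_ J) t).
  by rewrite sqrrB; move: (T phi t) ((g \_ J) t) => x y; lra.
rewrite RintegralZl//; last exact: integrable_mul_sqr mI mT mgJ iT igJ.
rewrite RintegralD// TgJE gJE mulr_natl mulr2n => le_var.
rewrite phi2E in leT.
by move: (le_trans le_var (lerD leT (lexx _))); rewrite lerD2l.
Qed.

End fluctuation.
End variance_bound.

(** * From the root of the tree to the Bellman function *)

Section majorant.
Context {R : realType}.
Local Notation mu := (@lebesgue_measure R).

Lemma bounded_lebesgue_lty (I : set R) :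
  measurable I -> bounded_set I -> (mu I < +oo)%E.
Proof.
move=> mI [M [_ /(_ (M + 1)) IM]].
apply: (@le_lt_trans _ _ (mu `[- (M + 1), M + 1]%classic)).
  apply: le_measure; rewrite ?inE// => t It.
  by rewrite /= in_itv/= -ler_norml IM// ltrDl.
by rewrite lebesgue_measure_itv/=; case: ifP => // _; rewrite -EFinB ltry.
Qed.

Lemma average_EFin (A : set R) (u : R -> R) : measurable A ->
  mu.-integrable A (EFin \o u) ->
  average A u = ((\int[mu]_(t in A) u t) / fine (mu A))%:E.
Proof.
move=> mA iu; rewrite /average mulrC EFinM /Rintegral fineK//.
exact: integrable_fin_num iu.
Qed.

(** An infinite integral of a nonnegative function would give an infinite average. *)
Lemma integrable_average (A : set R) (u : R -> R) x : measurable A ->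
    0 < fine (mu A) -> measurable_fun A u -> (forall t, A t -> 0 <= u t) ->
  average A u = x%:E -> mu.-integrable A (EFin \o u).
Proof.
move=> mA A0 mu_ u0 ux; apply/integrableP; split; first exact/measurable_EFinP.
have -> : (\int[mu]_(t in A) `|(EFin \o u) t| = \int[mu]_(t in A) (u t)%:E)%E.
  by apply: eq_integral => t /set_mem At; rewrite gee0_abs// lee_fin u0.
rewrite ltey; apply/eqP => uoo; move: ux; rewrite /average uoo.
by rewrite gt0_muley// lte_fin invr_gt0.
Qed.

(** (B2) with one child of weight 1 and [d] the root of [x2' - x2]; the diameter term is
    nonnegative. *)
Lemma classK_decreasing (H : completeNormedModType R) (p q delta : R)
    (B : H * R * R * R -> R) x1 x2 x2' x3 x4 :
  classK p q delta B -> delta <= 1 -> x2 <= x2' ->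
  Omega p q (x1, x2, x3, x4) -> Omega p q (x1, x2', x3, x4) ->
  B (x1, x2', x3, x4) <= B (x1, x2, x3, x4).
Proof.
move=> [_ _ KB] d1 x22 Ox Ox'.
have := KB 1%N (x1, x2, x3, x4) (fun=> (x1, x2', x3, x4)) (Num.sqrt (x2' - x2))
  (fun=> 1) Ox (fun=> Ox') (fun=> d1).
rewrite !big_ord1 scale1r mul1r sqr_sqrtr ?subr_ge0// => /(_ erefl).
have -> : (x1, x2', x3, x4) - (x1, x2, x3, x4) = (0, x2' - x2, 0, 0).
  by congr (_, _, _, _); rewrite /= subrr.
move=> /(_ erefl); apply: le_trans; rewrite lerDr mulr_ge0//.
exact: le_trans (normr_ge0 _) (le_diam (fun=> x1) ord0 ord0).
Qed.

End majorant.

Theorem theorem1 (R : realType) (I : set R)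
    (itvI : is_interval I) (bndI : bounded_set I)
    (posI : (0 < lebesgue_measure I)%E)
    (H : completeNormedModType R) (dot : {dot H for idfun})
    (hilH : separable_hilbert dot)
    (p q : R) (p_gt1 : 1 < p) (p_le2 : p <= 2) (pq : p^-1 + q^-1 = 1)
    (delta : R) (delta_gt0 : 0 < delta) (delta_le : delta <= 2^-1)
    (F : nat -> set (set R)) (regF : regular_filtration I delta F)
    (B : H * R * R * R -> R) (KB : classK p q delta B) :
  forall x : H * R * R * R, Omega_bellman dot I F p q x ->
    (bellman dot I F p q x <= (B x)%:E)%E.
Proof.
move=> [[[x1 x2] x3] x4] [x20 x30 x40 _]; apply: ge_ereal_sup => y.
move=> [f [g [T [h [[ssf g2 TG adjT] [x1E x2E x3E x4E ->]]]]]].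
have [dotE _] := hilH.
have mI : measurable I by exact: is_interval_measurable.
have Ioo := bounded_lebesgue_lty mI bndI.
(* From [p <= 2], [1/q = 1 - 1/p <= 1/2]. This permits Jensen with exponent [q / 2]. *)
have q2 : 2 <= q.
  have p0 : 0 < p by rewrite (lt_trans _ p_gt1).
  have p1 : p^-1 < 1 by rewrite invf_lt1.
  have p2 : 2^-1 <= p^-1 by rewrite lef_pV2 ?posrE.
  have q0 : 0 < q by rewrite -invr_gt0; lra.
  by rewrite -lef_pV2 ?posrE//; lra.
have [N sf] := simple_space_step regF ssf.
have FI := filtration_I regF 0; have aI := atomI posI regF.
have m0 := atom_gt0 Ioo posI delta_gt0 regF aI.
set W := span (f @` I).
have fW t : I t -> W (f t) by move=> It; apply: sub_span; exists t.
have finW : exists s : seq H, W = span [set` s].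
  exists (fset_set (f @` I)); rewrite fset_setK//.
  exact: (finite_step (filtration_algebra regF N) (filtration_I regF N) sf).
have ih v := integrable_dot_h dotE mI Ioo regF adjT v.
have [ha haP] := exists_average dotE mI Ioo posI delta_gt0 regF finW ih.
have haW n J : atom (F n) J -> W (ha J) by move=> /haP[].
have haE n J v : atom (F n) J -> W v ->
    fine (lebesgue_measure J) * dot v (ha J) =
    \int[lebesgue_measure]_(t in J) dot v (h t) by move=> /haP[_]; apply.
have ig := integrable_g mI g2.
have mg := bmeasurable_measurable_fun mI g2.1.
(* Integrability comes from the prescribed finite value [x4] of the average. *)
have igq : (@lebesgue_measure R).-integrable I (EFin \o (fun t => `|g t| `^ q)).
  apply: (integrable_average mI m0 _ _ x4E); last by move=> t _; exact: powR_ge0.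
  have mng : measurable_fun I (fun t => `|g t|).
    by apply: measurableT_comp mg; exact: normr_measurable.
  exact: (measurableT_comp (measurable_powR q) mng).
have var_le n J (nN : (n <= N)%N) (aJ : atom (F n) J) :=
  variance_le dotE mI Ioo posI delta_gt0 regF TG g2 adjT finW haW haE nN aJ.
have p1 := ltW p_gt1.
have if_ : (@lebesgue_measure R).-integrable I (EFin \o (fun t => `|f t| `^ p)).
  exact: (integrable_step mI Ioo regF (step_comp (fun x : H => `|x| `^ p) sf) FI).
have Ob := bellman_point_Omega dotE mI Ioo posI delta_gt0 regF sf p1 q2 ig igq
  var_le (leq0n N) aI.
have := defect_le dotE mI Ioo posI delta_gt0 regF finW ih haW haE sf fW p1 q2 ig
  igq var_le KB (leq0n N) aI.
set b := bellman_point F ha N f p q g I => defectB.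
have iD := integrable_dot_sub mI Ioo regF finW ih haE sf fW (leq0n N) FI
  (baverageW dotE mI Ioo regF finW sf fW aI).
(* The function [f - <f>] is a step function, so the adjoint identity moves the operator onto
   [g]. *)
have -> : average I (fun t => g t * T (fun s => f s - baverage I f) t) =
    (defect dot h f I / fine (lebesgue_measure I))%:E.
  have [_ _ _ adjE] := T_step dotE mI Ioo posI delta_gt0 regF TG adjT
    (step_comp (fun x => x - baverage I f) sf).
  rewrite -(average_EFin mI iD) /average; congr (_ * _)%E.
  by rewrite -adjE; apply: eq_integral => t _; rewrite mulrC.
apply: (@le_trans _ _ (B b)%:E).
  by rewrite lee_fin ler_pdivrMr// mulrC.
(* The root point [b] can differ from the given point in the second entry only. *)
have bE : b = (x1, b.1.1.2, x3, x4).
  rewrite /b /bellman_point x1E; congr (_, _, _, _).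
    by move: x3E; rewrite (average_EFin mI if_) => -[].
  by move: x4E; rewrite (average_EFin mI igq) => -[].
(* The given [x2] subtracts the variance of [h], whereas [b] subtracts that of its projection, which
   is no larger. *)
have x2b : x2 <= b.1.1.2.
  have ihc := integrable_center dotE mI Ioo regF adjT (baverage I h).
  move: x2E; rewrite (average_EFin mI ig) /osc2 (average_EFin mI ihc) -EFinB.
  move=> -[<-]; rewrite -mulrBl ler_pM2r ?invr_gt0// lerD2l lerN2.
  exact: (variance_le_center dotE mI Ioo posI delta_gt0 regF adjT finW haW haE).
rewrite lee_fin bE; rewrite -/b bE in Ob.
have d1 : delta <= 1 by rewrite (le_trans delta_le)// invf_le1// ler1n.
apply: (classK_decreasing KB d1 x2b _ Ob).
(* The given point lies in [Omega] too: its second entry is nonnegative and at most that of [b]. *)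
have [b0 _ _ fp gq] := Ob; split=> //; apply: le_trans gq.
by apply: ge0_ler_powR => //; rewrite (le_trans _ q2).
Qed.
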